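(* In the topological case, $\Phi\text{-}\mathsf{Mod}$ is dually equivalent to the category $\Phi\text{-}\mathsf{ATop}_{\sup}$ of $\Phi$-algebraic topological T$_0$-spaces and $\Phi$-cocontinuous continuous maps; in the approach case, $\Phi\text{-}\mathsf{Mod}$ is dually equivalent to the category $\Phi\text{-}\mathsf{AApp}_{\sup}$ of $\Phi$-algebraic approach T$_0$-spaces and $\Phi$-cocontinuous contraction maps.
   Context: Two parallel cases are treated. Topological case: $\mathsf V=\{\mathrm{false},\mathrm{true}\}=\{0,1\}$, $\otimes=\&$, $k=\mathrm{true}$, $\mathrm{false}\sqsubseteq\mathrm{true}$. Approach case: $\mathsf V=[0,\infty]$, $\otimes=+$, $k=0$, $u\sqsubseteq v$ iff $u\ge v$ numerically (so joins $\bigvee$ in $\mathsf V$ are numerical infima and meets $\bigwedge$ are numerical suprema). A $\mathsf V$-relation $r\colon X\nrightarrow Y$ is a function $X\times Y\to\mathsf V$; composition is $(s\cdot r)(x,z)=\bigvee_y r(x,y)\otimes s(y,z)$; $r^\circ(y,x)=r(x,y)$; $\mathsf V$-relations are ordered pointwise by $\sqsubseteq$; a function is viewed as the $\mathsf V$-relation given by its graph (true $\mapsto k$, false $\mapsto$ bottom of $\mathsf V$). $UX$ is the set of ultrafilters on $X$, $Uf$ the image-ultrafilter map, $e_X(x)$ the principal ultrafilter at $x$, $m_X\colon UUX\to UX$, $m_X(\mathfrak X)=\{A\subseteq X\mid A^\#\in\mathfrak X\}$ with $A^\#=\{\mathfrak x\in UX\mid A\in\mathfrak x\}$. For $r\colon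 X\nrightarrow Y$, $Ur(\mathfrak x,\mathfrak y)=\bigwedge_{A\in\mathfrak x,B\in\mathfrak y}\bigvee_{x\in A,y\in B}r(x,y)$. A space is a pair $(X,a)$ with $a\colon UX\nrightarrow X$, $e_X^\circ\sqsubseteq a$ and $a\cdot Ua\cdot m_X^\circ\sqsubseteq a$; in the topological case these are exactly the topological spaces with their ultrafilter convergence, in the approach case these are the approach spaces. A map $f\colon(X,a)\to(Y,b)$ of spaces is a function with $a(\mathfrak x,x)\sqsubseteq b(Uf(\mathfrak x),f(x))$ (continuous, respectively contraction, map). The categories are $\mathsf{Top}$ and $\mathsf{App}$. Maps are ordered by $f\le g$ iff $k\sqsubseteq b(e_Y(f(x)),g(x))$ for all $x$; $f\cong g$ means $f\le g$ and $g\le f$; $f\dashv g$ means $1\le g\cdot f$ and $f\cdot g\le 1$. The underlying order of $X$ is $x\le y$ iff $k\sqsubseteq a(e_X(x),y)$; $X$ is T$_0$ if this order is anti-symmetric. $X\otimes Y$ is $X\times Y$ with structure $c(\mathfrak w,(x,y))=a(U\pi_1(\mathfrak w),x)\otimes b(U\pi_2(\mathfrak w),y)$. $\mathsf V$ is a space: the Sierpiński space with $\{1\}$ closed, respectively $[0,\infty]$ with $\lambda(\mathfrak u,x)=\max\{x-\xi(\mathfrak u),0\}$ (with $\infty-\infty=0$), $\xi(\mathfrak u)=\sup_{A\in\mathfrak u}\inf A$. A $\mathsf U$-relation $r\colon X\rightharpoonup Y$ is a $\mathsf V$-relation $UX\nrightarrow Y$; Kleisli composition is $s\circ r=s\cdot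 Ur\cdot m_X^\circ$. A $\mathsf U$-module $\varphi\colon(X,a)\rightharpoonup(Y,b)$ is a $\mathsf U$-relation with $\varphi\circ a=\varphi$ and $b\circ\varphi=\varphi$; spaces and $\mathsf U$-modules form an ordered category $\mathsf U\text{-}\mathsf{Mod}$ with identities $a$. Each map $f\colon X\to Y$ gives $\mathsf U$-modules $f_*\colon X\rightharpoonup Y$, $f_*(\mathfrak x,y)=b(Uf(\mathfrak x),y)$, and $f^*\colon Y\rightharpoonup X$, $f^*(\mathfrak y,x)=b(\mathfrak y,f(x))$. For $x\in X$, $x^*=a(-,x)\colon X\rightharpoonup 1$, where $1$ is the one-point space. $X^{\mathrm{op}}$ is the space on $UX$ with structure $(\mathfrak X,\mathfrak x)\mapsto(Ua\cdot m_X^\circ)(\mathfrak x,m_X(\mathfrak X))$. $PX$ is the set of $\mathsf U$-modules $\psi\colon X\rightharpoonup 1$ (equivalently, maps $X^{\mathrm{op}}\to\mathsf V$) with the structure of the exponential $\mathsf V^{X^{\mathrm{op}}}$, i.e. the unique one such that for each space $Z$ a function $h\colon Z\to PX$ is a map iff $(z,\mathfrak x)\mapsto h(z)(\mathfrak x)$ is a map $Z\otimes X^{\mathrm{op}}\to\mathsf V$ (this structure exists). Standing assumption: $\Phi\text{-}\mathsf{Mod}$ is a subcategory of $\mathsf U\text{-}\mathsf{Mod}$ (on all spaces) which contains $f^*$ for every map $f$ of spaces, and such that a $\mathsf U$-module $\varphi\colon X\rightharpoonup Y$ is in $\Phi\text{-}\mathsf{Mod}$ iff $y^*\circ\varphi$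 is in $\Phi\text{-}\mathsf{Mod}$ for all $y\in Y$. $\Phi X=\{\psi\in PX\mid\psi\in\Phi\text{-}\mathsf{Mod}\}$ is a subspace of $PX$, and $y_X^\Phi\colon X\to\Phi X$, $x\mapsto x^*$. $X$ is $\Phi$-cocomplete if $y_X^\Phi$ has a left adjoint $\mathrm{Sup}_X^\Phi\colon\Phi X\to X$ in $\mathsf{Top}$/$\mathsf{App}$; a $\Phi$-cocomplete T$_0$-space $X$ is $\Phi$-distributive if $\mathrm{Sup}_X^\Phi$ has a left adjoint in $\mathsf{Top}$/$\mathsf{App}$. A $\Phi$-distributive T$_0$-space is $\Phi$-algebraic if it is isomorphic (in $\mathsf{Top}$/$\mathsf{App}$) to $\Phi Y$ for some space $Y$. A colimit of a map $d\colon B\to X$ weighted by $\psi\colon B\rightharpoonup A$ in $\Phi\text{-}\mathsf{Mod}$ is a map $g\colon A\to X$ such that $g_*$ is the largest $\mathsf U$-module $\gamma\colon A\rightharpoonup X$ with $\gamma\circ\psi\sqsubseteq d_*$. A map $f\colon X\to Y$ is $\Phi$-cocontinuous if it preserves all such colimits which exist in $X$ (for $g$ a colimit of $d$ weighted by $\psi$, $f\cdot g$ is a colimit of $f\cdot d$ weighted by $\psi$); for $X,Y$ $\Phi$-cocomplete this is equivalent to $f\cdot\mathrm{Sup}_X^\Phi\cong\mathrm{Sup}_Y^\Phi\cdot\Phi f$, where $\Phi f(\psi)=\psi\circ f^*$. *)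

(* Defs.v *)
From HB Require Import structures.
From mathcomp Require Import all_boot all_order all_algebra.
From mathcomp Require Import all_classical all_reals ereal.

Set Implicit Arguments.
Unset Strict Implicit.
Unset Printing Implicit Defensive.

Import Order.TTheory GRing.Theory Num.Theory.

Local Open Scope classical_set_scope.

Record ultrafilter (X : Type) := Ultrafilter {
  ufset :> set X -> Prop;
  ufsetP : UltraFilter ufset }.

Lemma ultrafilter_eq X (F G : ultrafilter X) :
  (forall A, F A <-> G A) -> F = G.
Proof.
case: F G => [F FU] [G GU] /= FG.
have E : F = G by apply/funext => A; apply/propext.
by subst G; congr Ultrafilter; exact: Prop_irrelevance.
Qed.

Lemma ultra_of_dichotomy X (F : set_system X) : ProperFilter F ->
  (forall A, F A \/ F (~` A)) -> UltraFilter F.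
Proof.
move=> FF FC; split=> // G GG FG; apply/seteqP; split=> // A GA.
case: (FC A) => // /FG GnA; case: (@filter_not_empty _ G GG).
by rewrite -(setICr A); apply: filterI.
Qed.

Section UltrafilterTheory.
Variables (X : Type) (F : ultrafilter X).

Let FP : ProperFilter (ufset F) := @ultra_proper _ _ (ufsetP F).

Lemma uf_set0 : ~ F set0. Proof. exact: (@filter_not_empty _ _ FP). Qed.

Lemma uf_setT : F setT. Proof. exact: (@filterT _ _ FP). Qed.

Lemma uf_setI A B : F A -> F B -> F (A `&` B).
Proof. exact: (@filterI _ _ FP). Qed.

Lemma uf_sub A B : A `<=` B -> F A -> F B.
Proof. exact: (@filterS _ _ FP). Qed.

Lemma uf_setVsetC A : F A \/ F (~` A).
Proof. exact: in_ultra_setVsetC (ufsetP F). Qed.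

End UltrafilterTheory.

Lemma uimage_subproof X Y (f : X -> Y) (F : ultrafilter X) :
  UltraFilter (fmap f (ufset F)).
Proof.
apply: ultra_of_dichotomy => [|A]; last exact: (uf_setVsetC F (f @^-1` A)).
split; first exact: (@uf_set0 _ F).
split; first exact: (@uf_setT _ F).
  by move=> P Q /=; exact: uf_setI.
by move=> P Q PQ /=; apply: uf_sub => x; exact: PQ.
Qed.

Definition uimage X Y (f : X -> Y) (F : ultrafilter X) : ultrafilter Y :=
  Ultrafilter (uimage_subproof f F).

Definition uprincipal X (x : X) : ultrafilter X :=
  Ultrafilter (principal_filter_ultra x).

Lemma uprincipalP X (x : X) (A : set X) : uprincipal x A <-> A x.
Proof. exact: principal_filterP. Qed.

Lemma uimage_principal X Y (f : X -> Y) (x : X) :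
  uimage f (uprincipal x) = uprincipal (f x).
Proof.
apply: ultrafilter_eq => A.
exact: (iff_trans (uprincipalP x (f @^-1` A)) (iff_sym (uprincipalP (f x) A))).
Qed.

Definition usharp X (A : set X) : set (ultrafilter X) :=
  [set F : ultrafilter X | F A].

Lemma umult_subproof X (W : ultrafilter (ultrafilter X)) :
  UltraFilter [set A | W (usharp A)].
Proof.
apply: ultra_of_dichotomy => [|A] /=; last first.
  case: (uf_setVsetC W (usharp A)) => [|WnA]; [by left | right].
  apply: uf_sub WnA => F /= nFA.
  by case: (uf_setVsetC F A).
split=> /=.
  by move=> W0; apply: (@uf_set0 _ W); apply: uf_sub W0 => F /= /uf_set0.
split=> /=.
- by apply: uf_sub (uf_setT W) => F _; exact: uf_setT.
- move=> P Q /= WP WQ; apply: uf_sub (uf_setI WP WQ) => F /= -[].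
  exact: uf_setI.
- by move=> P Q PQ; apply: uf_sub => F /=; exact: uf_sub.
Qed.

Definition umult X (W : ultrafilter (ultrafilter X)) : ultrafilter X :=
  Ultrafilter (umult_subproof W).

(* [qle] is the order in which [qunit] is the top element, [qsup] and [qinf]
   are joins and meets for [qle], and [qconv] is the convergence structure
   which makes the set of truth values a space. *)
Record quantale := Quantale {
  qsort :> Type;
  qle : qsort -> qsort -> Prop;
  qsup : set qsort -> qsort;
  qinf : set qsort -> qsort;
  qmul : qsort -> qsort -> qsort;
  qunit : qsort;
  qconv : ultrafilter qsort -> qsort -> qsort;
  qle_refl : forall u, qle u u;
  qle_anti : forall u v, qle u v -> qle v u -> u = v;
  qle_trans : forall u v w, qle u v -> qle v w -> qle u w;
  qsup_ub : forall (S : set qsort) u, S u -> qle u (qsup S);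
  qsup_le : forall (S : set qsort) v,
    (forall u, S u -> qle u v) -> qle (qsup S) v;
  qinf_lb : forall (S : set qsort) u, S u -> qle (qinf S) u;
  qinf_ge : forall (S : set qsort) v,
    (forall u, S u -> qle v u) -> qle v (qinf S);
  qmulA : forall u v w, qmul u (qmul v w) = qmul (qmul u v) w;
  qmulC : forall u v, qmul u v = qmul v u;
  qmul1 : forall u, qmul qunit u = u;
  qmul_sup : forall u (S : set qsort),
    qmul u (qsup S) = qsup [set qmul u v | v in S];
  qle_unit : forall u, qle u qunit }.

Definition qbot (Q : quantale) : Q := qsup set0.

Definition sierpinski_open (O : set bool) : Prop :=
  O = set0 \/ O = [set false] \/ O = setT.

Definition sierpinski_conv (F : ultrafilter bool) (v : bool) : bool :=
  `[< forall O : set bool, sierpinski_open O -> O v -> F O >].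

Definition bool_sup (S : set bool) : bool := `[< S true >].
Definition bool_inf (S : set bool) : bool := ~~ `[< S false >].

Lemma bool_sup_ub (S : set bool) u : S u -> u ==> bool_sup S.
Proof. by case: u => // Su; apply/asboolP. Qed.

Lemma bool_sup_le (S : set bool) v :
  (forall u, S u -> u ==> v) -> bool_sup S ==> v.
Proof. by move=> Sv; apply/implyP => /asboolP /Sv. Qed.

Lemma bool_inf_lb (S : set bool) u : S u -> bool_inf S ==> u.
Proof.
case: u => Su; rewrite /bool_inf ?implybT //.
by have /asboolP -> := Su.
Qed.

Lemma bool_inf_ge (S : set bool) v :
  (forall u, S u -> v ==> u) -> v ==> bool_inf S.
Proof.
by move=> Sv; apply/implyP => vT; apply/asboolPn => /Sv; rewrite vT.
Qed.

Lemma bool_mul_sup u (S : set bool) :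
  u && bool_sup S = bool_sup [set u && v | v in S].
Proof.
apply/idP/idP => [/andP[uT /asboolP ST]|/asboolP[v Sv /andP[-> vT]]].
  by apply/asboolP; exists true; rewrite ?uT.
by apply/asboolP; rewrite -vT.
Qed.

Definition topological : quantale := {|
  qsort := bool;
  qle := fun u v => u ==> v;
  qsup := bool_sup;
  qinf := bool_inf;
  qmul := andb;
  qunit := true;
  qconv := sierpinski_conv;
  qle_refl := implybb;
  qle_anti := ltac:(by move=> [] []);
  qle_trans := ltac:(by move=> [] [] []);
  qsup_ub := bool_sup_ub;
  qsup_le := bool_sup_le;
  qinf_lb := bool_inf_lb;
  qinf_ge := bool_inf_ge;
  qmulA := andbA;
  qmulC := andbC;
  qmul1 := andTb;
  qmul_sup := bool_mul_sup;
  qle_unit := implybT |}.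

Section Approach.
Variable R : realType.
Local Open Scope ereal_scope.

Definition ennr := {x : \bar R | 0 <= x}.
Definition Ennr x (x0 : 0 <= x) : ennr := exist _ x x0.
Implicit Types (u v w : ennr) (S : set ennr) (F : ultrafilter ennr).

(* The reverse of the numerical order, so that joins are numerical infima. *)
Definition ennr_le u v : Prop := val v <= val u.

Lemma ennr0_subproof : (0 : \bar R) <= 0. Proof. exact: lexx. Qed.
Definition ennr0 : ennr := Ennr ennr0_subproof.

Lemma ennr_add_subproof u v : 0 <= val u + val v.
Proof. exact: adde_ge0 (valP u) (valP v). Qed.
Definition ennr_add u v : ennr := Ennr (ennr_add_subproof u v).

Lemma ennr_inf_subproof S : 0 <= ereal_inf [set val u | u in S].
Proof. by apply: le_ereal_inf_tmp => _ [u _ <-]; exact: valP. Qed.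
Definition ennr_inf S : ennr := Ennr (ennr_inf_subproof S).

(* The maximum with 0 only matters for [S = set0], since
   [ereal_sup set0 = -oo]. *)
Lemma ennr_sup_subproof S :
  0 <= Order.max 0 (ereal_sup [set val u | u in S]).
Proof. by rewrite le_max lexx. Qed.
Definition ennr_sup S : ennr := Ennr (ennr_sup_subproof S).

Definition ennr_xi F : ennr := ennr_sup [set ennr_inf A | A in ufset F].

(* In [\bar R], [+oo - +oo = -oo], so that the maximum below is then 0. *)
Lemma ennr_conv_subproof F u : 0 <= Order.max (val u - val (ennr_xi F)) 0.
Proof. by rewrite le_max lexx orbT. Qed.
Definition ennr_conv F u : ennr := Ennr (ennr_conv_subproof F u).

Lemma ennr_le_anti u v : ennr_le u v -> ennr_le v u -> u = v.
Proof.
by move=> uv vu; apply/val_inj/eqP; rewrite eq_le; apply/andP; split.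
Qed.

Lemma ennr_inf_lb S u : S u -> ennr_le u (ennr_inf S).
Proof. by move=> Su; apply: ereal_inf_lbound; exists u. Qed.

Lemma ennr_inf_ge S v : (forall u, S u -> ennr_le u v) -> ennr_le (ennr_inf S) v.
Proof. by move=> Sv; apply: le_ereal_inf_tmp => _ [u /Sv + <-]. Qed.

Lemma ennr_sup_ub S u : S u -> ennr_le (ennr_sup S) u.
Proof.
move=> Su; rewrite /ennr_le /= le_max; apply/orP; right.
by apply: ereal_sup_ubound; exists u.
Qed.

Lemma ennr_sup_le S v : (forall u, S u -> ennr_le v u) -> ennr_le v (ennr_sup S).
Proof.
move=> Sv; rewrite /ennr_le /= ge_max; apply/andP; split; first exact: valP.
by apply: ge_ereal_sup => _ [u /Sv + <-].
Qed.

Lemma ennr_add_inf u S :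
  ennr_add u (ennr_inf S) = ennr_inf [set ennr_add u v | v in S].
Proof.
set T := [set _ | _ in S].
apply: ennr_le_anti; last first.
  apply: ennr_inf_ge => _ [v Sv <-]; rewrite /ennr_le /=.
  by apply: leeD => //; exact: (ennr_inf_lb Sv).
have bP v : S v -> val (ennr_inf T) <= val u + val v.
  by move=> Sv; apply: (@ennr_inf_lb T (ennr_add u v)); exists v.
move: (ennr_inf T) bP => b bP; rewrite /ennr_le /=.
have I0 := ennr_inf_subproof S.
case: u {T} bP => [[r| |] u0] //= bP.
- rewrite addeC -leeBlDr//; apply: le_ereal_inf_tmp => _ [v /bP bv <-].
  by rewrite leeBlDr// addeC.
- by rewrite addye ?leey// gt_eqF// (lt_le_trans _ I0)// ltNye.
Qed.

Lemma ennr_addA u v w :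
  ennr_add u (ennr_add v w) = ennr_add (ennr_add u v) w.
Proof. by apply: val_inj; rewrite /= addeA. Qed.

Lemma ennr_addC u v : ennr_add u v = ennr_add v u.
Proof. by apply: val_inj; rewrite /= addeC. Qed.

Lemma ennr_add0 u : ennr_add ennr0 u = u.
Proof. by apply: val_inj; rewrite /= add0e. Qed.

Definition approach : quantale := {|
  qsort := ennr;
  qle := ennr_le;
  qsup := ennr_inf;
  qinf := ennr_sup;
  qmul := ennr_add;
  qunit := ennr0;
  qconv := ennr_conv;
  qle_refl := fun u => lexx (val u);
  qle_anti := ennr_le_anti;
  qle_trans := fun u v w uv vw => le_trans vw uv;
  qsup_ub := ennr_inf_lb;
  qsup_le := ennr_inf_ge;
  qinf_lb := ennr_sup_ub;
  qinf_ge := ennr_sup_le;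
  qmulA := ennr_addA;
  qmulC := ennr_addC;
  qmul1 := ennr_add0;
  qmul_sup := ennr_add_inf;
  qle_unit := fun u => valP u |}.

End Approach.

(* The laws are kept apart in [is_category], and are part of [equivalent]. *)
Record precategory := Precategory {
  obj :> Type;
  hom : obj -> obj -> Type;
  idm : forall x, hom x x;
  cmp : forall x y z, hom y z -> hom x y -> hom x z }.

Record is_category (C : precategory) : Prop := IsCategory {
  cmp1m : forall (x y : C) (f : hom x y), cmp (idm y) f = f;
  cmpm1 : forall (x y : C) (f : hom x y), cmp f (idm x) = f;
  cmpA : forall (x y z t : C) (h : hom z t) (g : hom y z) (f : hom x y),
    cmp h (cmp g f) = cmp (cmp h g) f }.

Definition opposite (C : precategory) : precategory := {|
  obj := C;
  hom := fun x y => @hom C y x;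
  idm := fun x => idm x;
  cmp := fun x y z g f => cmp f g |}.

Record functor (C D : precategory) := Functor {
  fobj :> C -> D;
  fhom : forall x y : C, hom x y -> hom (fobj x) (fobj y);
  fhom1 : forall x, fhom (idm x) = idm (fobj x);
  fhomM : forall (x y z : C) (g : hom y z) (f : hom x y),
    fhom (cmp g f) = cmp (fhom g) (fhom f) }.

Definition functor_id (C : precategory) : functor C C := {|
  fobj := fun x => x;
  fhom := fun x y f => f;
  fhom1 := fun x => erefl;
  fhomM := fun x y z g f => erefl |}.

Lemma functor_comp_subproof1 (C D E : precategory)
    (G : functor D E) (F : functor C D) (x : C) :
  fhom G (fhom F (idm x)) = idm (G (F x)).
Proof. by rewrite !fhom1. Qed.

Lemma functor_comp_subproofM (C D E : precategory)
    (G : functor D E) (F : functor C D) (x y z : C)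
    (g : hom y z) (f : hom x y) :
  fhom G (fhom F (cmp g f)) = cmp (fhom G (fhom F g)) (fhom G (fhom F f)).
Proof. by rewrite !fhomM. Qed.

Definition functor_comp (C D E : precategory)
    (G : functor D E) (F : functor C D) : functor C E := {|
  fobj := fun x => G (F x);
  fhom := fun x y f => fhom G (fhom F f);
  fhom1 := functor_comp_subproof1 G F;
  fhomM := @functor_comp_subproofM C D E G F |}.

Definition is_iso (C : precategory) (x y : C) (f : hom x y) : Prop :=
  exists g : hom y x, cmp g f = idm x /\ cmp f g = idm y.

Definition naturally_isomorphic (C D : precategory) (F G : functor C D) : Prop :=
  exists t : forall x : C, hom (F x) (G x),
    (forall (x y : C) (f : hom x y), cmp (fhom G f) (t x) = cmp (t y) (fhom F f))
    /\ (forall x, is_iso (t x)).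

Definition equivalent (C D : precategory) : Prop :=
  [/\ is_category C, is_category D &
    exists (F : functor C D) (G : functor D C),
      naturally_isomorphic (functor_comp G F) (functor_id C) /\
      naturally_isomorphic (functor_comp F G) (functor_id D)].

Definition dually_equivalent (C D : precategory) : Prop :=
  equivalent (opposite C) D.

Section Spaces.
Variable Q : quantale.

Definition vrel (X Y : Type) := X -> Y -> Q.

Definition vrel_le X Y (r s : vrel X Y) : Prop := forall x y, qle (r x y) (s x y).

Definition vcomp X Y Z (s : vrel Y Z) (r : vrel X Y) : vrel X Z :=
  fun x z => qsup [set qmul (r x y) (s y z) | y in setT].

Definition vconverse X Y (r : vrel X Y) : vrel Y X := fun y x => r x y.

Definition vgraph X Y (f : X -> Y) : vrel X Y :=
  fun x y => if `[< f x = y >] then qunit Q else qbot Q.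

Definition uext X Y (r : vrel X Y) : vrel (ultrafilter X) (ultrafilter Y) :=
  fun F G => qinf [set qsup [set r x y | x in A & y in B]
                  | A in ufset F & B in ufset G].

Definition urel (X Y : Type) := vrel (ultrafilter X) Y.

Definition kcomp X Y Z (s : urel Y Z) (r : urel X Y) : urel X Z :=
  vcomp s (vcomp (uext r) (vconverse (vgraph (@umult X)))).

Record ugraph := Ugraph { carrier :> Type; conv : urel carrier carrier }.

Definition is_space (X : ugraph) : Prop :=
  vrel_le (vconverse (vgraph (@uprincipal X))) (@conv X) /\
  vrel_le (kcomp (@conv X) (@conv X)) (@conv X).

Record space := Space { space_graph :> ugraph; spaceP : is_space space_graph }.

Definition is_map (X Y : ugraph) (f : X -> Y) : Prop :=
  forall (F : ultrafilter X) (x : X), qle (conv F x) (conv (uimage f F) (f x)).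

Definition map_le (X Y : ugraph) (f g : X -> Y) : Prop :=
  forall x, qle (qunit Q) (conv (uprincipal (f x)) (g x)).

Definition adjoint_maps (X Y : ugraph) (f : X -> Y) (g : Y -> X) : Prop :=
  [/\ is_map f, is_map g, map_le id (g \o f) & map_le (f \o g) id].

Definition underlying_le (X : ugraph) (x y : X) : Prop :=
  qle (qunit Q) (conv (uprincipal x) y).

Definition T0 (X : ugraph) : Prop :=
  forall x y : X, underlying_le x y -> underlying_le y x -> x = y.

Definition isomorphic (X Y : ugraph) : Prop :=
  exists (f : X -> Y) (g : Y -> X),
    [/\ is_map f, is_map g, cancel f g & cancel g f].

Definition tensor (X Y : ugraph) : ugraph :=
  @Ugraph (X * Y)%type
    (fun W p => qmul (conv (uimage fst W) p.1) (conv (uimage snd W) p.2)).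

Definition value_graph : ugraph := @Ugraph Q (@qconv Q).

Definition op_graph (X : ugraph) : ugraph :=
  @Ugraph (ultrafilter X)
    (fun W F => vcomp (uext (@conv X)) (vconverse (vgraph (@umult X)))
                  F (umult W)).

(* The structure with constant value [qunit], which is the only one when [X]
   has exactly one point. *)
Definition indiscrete_graph (X : Type) : ugraph :=
  @Ugraph X (fun _ _ => qunit Q).

Lemma indiscrete_graphP X : is_space (indiscrete_graph X).
Proof. by split=> F x; exact: qle_unit. Qed.

Definition one_space : space := Space (indiscrete_graphP unit).

Lemma uimage_comp X Y Z (g : Y -> Z) (f : X -> Y) (F : ultrafilter X) :
  uimage (g \o f) F = uimage g (uimage f F).
Proof. exact: ultrafilter_eq. Qed.

Lemma is_map_comp (X Y Z : ugraph) (g : Y -> Z) (f : X -> Y) :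
  is_map g -> is_map f -> is_map (g \o f).
Proof.
move=> gm fm F x; rewrite uimage_comp.
exact: qle_trans (fm F x) (gm _ _).
Qed.

Lemma is_map_id (X : ugraph) : is_map (@id X).
Proof.
move=> F x; suff -> : uimage id F = F by exact: qle_refl.
exact: ultrafilter_eq.
Qed.

Lemma qmul_le (u u' v v' : Q) : qle u u' -> qle v v' ->
  qle (qmul u v) (qmul u' v').
Proof.
have le_mul2l (w x y : Q) : qle x y -> qle (qmul w x) (qmul w y).
  move=> xy; have -> : y = qsup [set x; y].
    apply: qle_anti; first by apply: qsup_ub; right.
    by apply: qsup_le => z [] -> //; exact: qle_refl.
  by rewrite qmul_sup; apply: qsup_ub; exists x => //; left.
move=> uu' vv'; apply: (qle_trans (le_mul2l u _ _ vv')).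
by rewrite ![qmul _ v']qmulC; apply: le_mul2l.
Qed.

Definition induced_graph (X : Type) (Y : ugraph) (i : X -> Y) : ugraph :=
  @Ugraph X (fun F x => conv (uimage i F) (i x)).

Lemma uext_induced (X : Type) (Y : ugraph) (i : X -> Y)
    (W : ultrafilter (ultrafilter X)) (F : ultrafilter X) :
  qle (uext (@conv (induced_graph i)) W F)
      (uext (@conv Y) (uimage (uimage i) W) (uimage i F)).
Proof.
apply: qinf_ge => _ [A WA [B FB <-]].
set A' := uimage i @^-1` A; set B' := i @^-1` B.
apply: (@qle_trans Q _ (qsup [set (@conv (induced_graph i)) x y
                             | x in A' & y in B'])).
  by apply: qinf_lb; exists A' => //; exists B'.
apply: qsup_le => _ [G A'G [x B'x <-]]; apply: qsup_ub.
by exists (uimage i G) => //; exists (i x).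
Qed.

Lemma induced_graphP (X : Type) (Y : space) (i : X -> Y) :
  is_space (induced_graph i).
Proof.
have [Yrefl Ytrans] := spaceP Y; split.
  move=> F x; rewrite /vconverse /vgraph.
  case: asboolP => [<-|_]; last by apply: qsup_le.
  apply: qle_trans (Yrefl (uimage i (uprincipal x)) (i x)).
  rewrite /vconverse /vgraph asboolT; first exact: qle_refl.
  by rewrite uimage_principal.
move=> F x; apply: qsup_le => _ [G _ <-].
apply: qle_trans (Ytrans (uimage i F) (i x)).
apply: (@qle_trans Q _ (qmul (vcomp (uext (@conv Y))
   (vconverse (vgraph (@umult Y))) (uimage i F) (uimage i G))
   (conv (uimage i G) (i x)))); last by apply: qsup_ub; exists (uimage i G).
apply: qmul_le; last exact: qle_refl.
apply: qsup_le => _ [W _ <-].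
apply: (@qle_trans Q _ (qmul (vconverse (vgraph (@umult Y)) (uimage i F)
   (uimage (uimage i) W)) (uext (@conv Y) (uimage (uimage i) W) (uimage i G)))).
  apply: qmul_le; last exact: uext_induced.
  rewrite /vconverse /vgraph; case: asboolP => [<-|_]; last exact: qsup_le.
  rewrite asboolT; first exact: qle_refl.
  exact: ultrafilter_eq.
by apply: qsup_ub; exists (uimage (uimage i) W).
Qed.

Definition subspace (Y : space) (P : Y -> Prop) : space :=
  Space (induced_graphP (fun p : {y : Y | P y} => sval p)).

Definition is_module (X Y : ugraph) (r : urel X Y) : Prop :=
  kcomp r (@conv X) = r /\ kcomp (@conv Y) r = r.

Definition lower_star (X Y : ugraph) (f : X -> Y) : urel X Y :=
  fun F y => conv (uimage f F) y.

Definition upper_star (X Y : ugraph) (f : X -> Y) : urel Y X :=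
  fun G x => conv G (f x).

Definition point_star (X : ugraph) (x : X) : urel X one_space :=
  fun F _ => conv F x.

Definition presheaf (X : space) := {psi : urel X one_space | is_module psi}.

(* The exponential of [value_graph] by [op_graph X], carried by the modules
   from [X] to the one-point space. *)
Definition is_presheaf_structure (X : space)
    (d : urel (presheaf X) (presheaf X)) : Prop :=
  is_space (Ugraph d) /\
  forall (Z : space) (h : Z -> presheaf X),
    @is_map Z (Ugraph d) h <->
    @is_map (tensor Z (op_graph X)) value_graph (fun p => sval (h p.1) p.2 tt).

Lemma presheaf_structure_unique (X : space)
    (d d' : urel (presheaf X) (presheaf X)) :
  is_presheaf_structure d -> is_presheaf_structure d' -> d = d'.
Proof.
have sub d1 d2 : is_presheaf_structure d1 -> is_presheaf_structure d2 ->
    forall F p, qle (d1 F p) (d2 F p).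
  move=> [d1s d1P] [_ d2P] F p.
  have : @is_map (Ugraph d1) (Ugraph d2) id.
    apply: (proj2 (d2P (Space d1s) id)); apply: (proj1 (d1P (Space d1s) id)).
    exact: is_map_id.
  move=> /(_ F p) /=; suff -> : uimage id F = F by [].
  exact: ultrafilter_eq.
move=> dP d'P; apply/funext => F; apply/funext => p.
by apply: qle_anti; apply: sub.
Qed.

(* The definite description of the exponential structure, which always exists;
   the second branch only makes the definition total. *)
Definition presheaf_conv (X : space) : urel (presheaf X) (presheaf X) :=
  match pselect (exists d, @is_presheaf_structure X d) with
  | left ex => sval (cid ex)
  | right _ => fun _ _ => qunit Q
  end.

Lemma presheaf_conv_space (X : space) : is_space (Ugraph (@presheaf_conv X)).
Proof.
rewrite /presheaf_conv; case: pselect => [ex|_]; last exact: indiscrete_graphP.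
by case: (cid ex) => d [].
Qed.

Definition presheaf_space (X : space) : space := Space (presheaf_conv_space X).

(* [g] is a colimit of [d] weighted by [psi]. *)
Definition is_colimit (A B X : space) (psi : urel B A) (d : B -> X)
    (g : A -> X) : Prop :=
  [/\ is_map g,
      is_module (lower_star (X := A) (Y := X) g),
      vrel_le (kcomp (lower_star (X := A) (Y := X) g) psi)
              (lower_star (X := B) (Y := X) d) &
      forall gamma : urel A X, is_module gamma ->
        vrel_le (kcomp gamma psi) (lower_star (X := B) (Y := X) d) ->
        vrel_le gamma (lower_star (X := A) (Y := X) g)].

Record module_class := ModuleClass {
  mc_mem :> forall X Y : space, urel X Y -> Prop;
  mc_module : forall (X Y : space) (r : urel X Y), mc_mem r -> is_module r;
  mc_id : forall X : space, mc_mem (X := X) (Y := X) (@conv X);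
  mc_comp : forall (X Y Z : space) (s : urel Y Z) (r : urel X Y),
    mc_mem s -> mc_mem r -> mc_mem (X := X) (Y := Z) (kcomp s r);
  mc_upper_star : forall (X Y : space) (f : X -> Y), is_map f ->
    mc_mem (X := Y) (Y := X) (upper_star f);
  mc_pointwise : forall (X Y : space) (r : urel X Y), is_module r ->
    (mc_mem r <->
     forall y : Y, mc_mem (X := X) (Y := one_space) (kcomp (point_star y) r)) }.

Variable Phi : module_class.

Definition Phi_Mod_hom (X Y : space) := {r : urel X Y | Phi X Y r}.

Definition Phi_Mod : precategory := {|
  obj := space;
  hom := Phi_Mod_hom;
  idm := fun X => exist _ _ (mc_id Phi X);
  cmp := fun X Y Z (s : Phi_Mod_hom Y Z) (r : Phi_Mod_hom X Y) =>
    exist _ _ (mc_comp (svalP s) (svalP r)) |}.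

Definition Phi_space (X : space) : space :=
  @subspace (presheaf_space X) (fun psi : presheaf X => Phi X one_space (sval psi)).

Lemma point_map (X : space) (x : X) : is_map (X := one_space) (fun _ => x).
Proof.
move=> F [] /=; apply: qle_trans ((spaceP X).1 _ x).
rewrite /vconverse /vgraph asboolT; first exact: qle_refl.
apply: ultrafilter_eq => A; split=> [/uprincipalP Ax|FA].
  by apply: (@uf_sub _ F setT) (uf_setT F) => y _.
apply/uprincipalP.
apply: contrapT => nAx; apply: (@uf_set0 _ F).
by apply: (@uf_sub _ F ((fun=> x) @^-1` A)).
Qed.

Lemma Phi_point_star (X : space) (x : X) : Phi X one_space (point_star x).
Proof. exact: (@mc_upper_star Phi one_space X (fun=> x) (point_map x)). Qed.

Definition yoneda (X : space) (x : X) : Phi_space X :=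
  exist (fun psi : presheaf X => Phi X one_space (sval psi))
    (exist _ (point_star x) (mc_module (Phi_point_star x))) (Phi_point_star x).

Definition Phi_cocomplete (X : space) : Prop :=
  exists Sup : Phi_space X -> X, adjoint_maps Sup (@yoneda X).

(* For a T0 space there is at most one [Sup]. *)
Definition Phi_distributive (X : space) : Prop :=
  [/\ T0 X, Phi_cocomplete X &
      forall Sup : Phi_space X -> X, adjoint_maps Sup (@yoneda X) ->
        exists t : X -> Phi_space X, adjoint_maps t Sup].

Definition Phi_algebraic (X : space) : Prop :=
  Phi_distributive X /\ exists Y : space, isomorphic X (Phi_space Y).

Definition Phi_cocontinuous (X Y : space) (f : X -> Y) : Prop :=
  forall (A B : space) (psi : urel B A) (d : B -> X) (g : A -> X),
    Phi B A psi -> is_map d ->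
    is_colimit psi d g -> is_colimit psi (f \o d) (f \o g).

Definition Phi_alg_hom (X Y : space) :=
  {f : X -> Y | is_map f /\ Phi_cocontinuous f}.

Lemma Phi_alg_id_subproof (X : space) : is_map (@id X) /\ Phi_cocontinuous (@id X).
Proof. by split; first exact: is_map_id. Qed.

Lemma Phi_alg_comp_subproof (X Y Z : space)
    (g : Phi_alg_hom Y Z) (f : Phi_alg_hom X Y) :
  is_map (sval g \o sval f) /\ Phi_cocontinuous (sval g \o sval f).
Proof.
case: g f => [g [gm gc]] [f [fm fc]] /=; split; first exact: is_map_comp.
move=> A B psi d h Ppsi dm hc.
exact: (gc A B psi (f \o d) (f \o h) Ppsi (is_map_comp fm dm) (fc _ _ _ _ _ Ppsi dm hc)).
Qed.

Definition Phi_Alg_sup : precategory := {|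
  obj := {X : space | Phi_algebraic X};
  hom := fun X Y => Phi_alg_hom (sval X) (sval Y);
  idm := fun X => exist _ _ (Phi_alg_id_subproof (sval X));
  cmp := fun X Y Z g f => exist _ _ (Phi_alg_comp_subproof g f) |}.

End Spaces.

(* Main.v *)
(* [Phi X] is the free Phi-cocomplete space on [X]: the modules [r : Y -o X] in
   Phi correspond to the maps [X -> Phi Y], and these to the Phi-cocontinuous
   maps [Phi X -> Phi Y], through [p |-> p o r], because every [p] in [Phi X] is
   the colimit of the Yoneda embedding weighted by [p].  Thus [X |-> Phi X] is a
   fully faithful functor on the opposite of Phi-Mod, and its image consists, up
   to isomorphism, of the Phi-algebraic spaces: the supremum of [Phi X] is the
   composition with [y_*], which has the composition with [y^*] as left adjoint.
   This rests on the associativity of Kleisli composition and on the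
   description of the structure of [P X] as the lifting of the evaluation module
   [X -o P X] through itself, so that [c <= d_*] iff [c o (transpose of d)] is
   below the evaluation.  Both hold as soon as the truth values form a completely
   distributive quantale whose multiplication preserves nonempty meets: an
   element is then the join of the elements totally below it, and the extension
   of a relation to ultrafilters can be computed on cuts, where it reduces to
   the existence of ultrafilters. *)

Require Import Defs.
From mathcomp Require Import all_boot all_order all_algebra.
From mathcomp Require Import all_classical all_reals ereal.
(* [all_algebra] shadows [space]. *)
Import Defs.

Set Implicit Arguments.
Unset Strict Implicit.
Unset Printing Implicit Defensive.

Import Order.TTheory GRing.Theory Num.Theory.

Local Open Scope classical_set_scope.

Lemma sig_eq T (P : T -> Prop) (s t : {x | P x}) : sval s = sval t -> s = t.
Proof. by case: s t => [x Px] [y Py] /=; exact: eq_exist. Qed.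

(** * Fully faithful and essentially surjective functors *)

Section Equivalence.
Variables (C D : precategory) (F : functor C D).
Hypotheses (Ccat : is_category C) (Dcat : is_category D).
Hypothesis F_full : forall x y (g : hom (F x) (F y)), exists f, fhom F f = g.
Hypothesis F_faithful :
  forall x y (f g : hom x y), fhom F f = fhom F g -> f = g.
Hypothesis F_surj : forall d, exists c (i : hom (F c) d), is_iso i.

Lemma fully_faithful_equivalent : equivalent C D.
Proof.
split=> //.
pose c d := sval (cid (F_surj d)).
pose i d : hom (F (c d)) d := sval (cid (svalP (cid (F_surj d)))).
have iP d : is_iso (i d) := svalP (cid (svalP (cid (F_surj d)))).
pose j d := sval (cid (iP d)).
have ji d : cmp (j d) (i d) = idm _ := (svalP (cid (iP d))).1.
have ij d : cmp (i d) (j d) = idm _ := (svalP (cid (iP d))).2.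
pose lift x y (g : hom (F x) (F y)) := sval (cid (F_full g)).
have liftK x y (g : hom (F x) (F y)) : fhom F (lift x y g) = g :=
  svalP (cid (F_full g)).
(* Conjugation by the chosen isomorphisms, pulled back along [F]. Every law below is checked after
   applying [F], which is faithful. *)
pose G1 d d' (g : hom d d') := lift (c d) (c d') (cmp (j d') (cmp g (i d))).
have G11 d : G1 d d (idm d) = idm (c d).
  by apply: F_faithful; rewrite liftK (cmp1m Dcat) ji fhom1.
have G1M d d' d'' (g : hom d' d'') (f : hom d d') :
    G1 d d'' (cmp g f) = cmp (G1 d' d'' g) (G1 d d' f).
  apply: F_faithful; rewrite fhomM !liftK -!(cmpA Dcat).
  by rewrite [cmp (i d') _](cmpA Dcat) ij (cmp1m Dcat).
pose G : functor D C := @Functor D C c G1 G11 G1M.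
exists F, G; split.
  exists (fun x => lift (c (F x)) x (i (F x))); split=> [x y f|x] /=.
    apply: F_faithful; rewrite !fhomM !liftK.
    by rewrite (cmpA Dcat) ij (cmp1m Dcat).
  exists (lift x (c (F x)) (j (F x))); split; apply: F_faithful;
    by rewrite fhomM !liftK fhom1 ?ji ?ij.
exists i; split=> [d d' f|d] /=; last by exists (j d).
by rewrite liftK (cmpA Dcat) ij (cmp1m Dcat).
Qed.

End Equivalence.

(** * Ultrafilters *)

Lemma uf_ex X (F : ultrafilter X) (A : set X) : F A -> exists x, A x.
Proof.
move=> FA; apply: contrapT => nA; apply: (@uf_set0 _ F).
by apply: uf_sub FA => x Ax; apply: nA; exists x.
Qed.

Lemma uf_eq_sub X (F G : ultrafilter X) : (forall A, F A -> G A) -> F = G.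
Proof.
move=> FG; apply: ultrafilter_eq => A; split=> [/FG //|GA].
case: (uf_setVsetC F A) => // /FG GnA.
by have [x []] := uf_ex (uf_setI GA GnA).
Qed.

Lemma uimage_id X (F : ultrafilter X) : uimage id F = F.
Proof. exact: ultrafilter_eq. Qed.

Lemma uimage_eq_on X Y (f g : X -> Y) (F : ultrafilter X) (A : set X) :
  F A -> (forall x, A x -> f x = g x) -> uimage f F = uimage g F.
Proof.
move=> FA fg; apply: uf_eq_sub => B FB.
by apply: uf_sub (uf_setI FA FB) => x [Ax] /=; rewrite fg.
Qed.

Lemma umult_uimage_principal X (F : ultrafilter X) :
  umult (uimage (@uprincipal X) F) = F.
Proof. apply/esym/uf_eq_sub => A FA.
suff : F [set x | uprincipal x A] by [].
by apply: uf_sub FA => x Ax; apply/uprincipalP. Qed.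

Lemma umult_principal X (F : ultrafilter X) : umult (uprincipal F) = F.
Proof. by apply: uf_eq_sub => A /uprincipalP. Qed.

Lemma umult_umult X (V : ultrafilter (ultrafilter (ultrafilter X))) :
  umult (umult V) = umult (uimage (@umult X) V).
Proof. exact: uf_eq_sub. Qed.

Lemma uimage_umult X Y (f : X -> Y) (W : ultrafilter (ultrafilter X)) :
  uimage f (umult W) = umult (uimage (uimage f) W).
Proof. exact: uf_eq_sub. Qed.

(** The rectangles with sides in [F] and [G], cut down to [R], generate a proper filter, and any
    ultrafilter refining it will do. All ultrafilters built below by choice come from here. [F] is
    only a filter, so that the first marginal can be prescribed in part. *)
Lemma ultra_lift X Y (R : X -> Y -> Prop) (F : set_system X)
    (G : ultrafilter Y) :
  Filter F ->
  (forall A B, F A -> G B -> exists x y, [/\ A x, B y & R x y]) ->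
  exists W : ultrafilter (X * Y),
    [/\ W [set p | R p.1 p.2],
        forall A, F A -> uimage fst W A & uimage snd W = G].
Proof.
move=> FF FGR.
pose H : set_system (X * Y) := [set C | exists A B, [/\ F A, G B &
  forall x y, A x -> B y -> R x y -> C (x, y)]].
have HP : ProperFilter H.
  split.
    by move=> [A [B [FA GB AB0]]]; have [x [y []]] := FGR _ _ FA GB; apply: AB0.
  split.
  - by exists setT, setT; split=> //; [exact: filterT | exact: uf_setT].
  - move=> C C' [A [B [FA GB AB]]] [A' [B' [FA' GB' AB']]].
    exists (A `&` A'), (B `&` B'); split; [exact: filterI|exact: uf_setI|].
    by move=> x y [Ax A'x] [By B'y] Rxy; split; [apply: AB | apply: AB'].
  - move=> C C' CC' [A [B [FA GB AB]]]; exists A, B; split=> // x y Ax By Rxy.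
    by apply: CC'; apply: AB.
have [W [WU HW]] := ultraFilterLemma HP.
exists (Ultrafilter WU); split.
- apply: HW; exists setT, setT; split=> //; [exact: filterT | exact: uf_setT].
- move=> A FA; apply: HW; exists A, setT; split=> //; exact: uf_setT.
- apply/esym/uf_eq_sub => B GB.
  by apply: HW; exists setT, B; split=> //; exact: filterT.
Qed.

Lemma uf_pair_ex X Y (W : ultrafilter (X * Y)) C A B : W C ->
  uimage fst W A -> uimage snd W B -> exists p, [/\ A p.1, B p.2 & C p].
Proof.
move=> WC WA WB; have := uf_setI (uf_setI (WA : W (fst @^-1` A)) WB) WC.
by case/uf_ex => p [[Ap Bp] Cp]; exists p.
Qed.

(** * Ultrafilter extension and Kleisli composition *)

Section Quantale.
Variable Q : quantale.
Implicit Types (u v w : Q) (S : set Q).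

(** On [[0,+oo]] this is the strict numerical inequality [v < u]; on truth values it says that [v]
    is true. *)
Definition totally_below u v :=
  forall S, qle v (qsup S) -> exists2 s, S s & qle u s.

(* [totally_below_dense] is complete distributivity; [qconvP] describes the space
   of truth values as the residuation of [v] by the [xi F] of the paper. *)
Record ultra_quantale : Prop := UltraQuantale {
  totally_below_dense : forall v, qle v (qsup [set u | totally_below u v]);
  qmul_inf_ge : forall u v S, S !=set0 ->
    (forall s, S s -> qle u (qmul v s)) -> qle u (qmul v (qinf S));
  qconvP : forall (F : ultrafilter Q) u v,
    qle u (qconv F v) <-> qle (qmul u (qinf [set qsup A | A in ufset F])) v }.

Variable HQ : ultra_quantale.

(** * Approximation by totally below elements *)

Lemma totally_below_le u v : totally_below u v -> qle u v.
Proof. by move=> /(_ [set v]) [|s /= -> //]; exact: qsup_ub. Qed.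

Lemma le_of_totally_below v w :
  (forall u, totally_below u v -> qle u w) -> qle v w.
Proof.
by move=> uw; apply: qle_trans (totally_below_dense HQ v) _; exact: qsup_le.
Qed.

(** By density, the elements totally below some member of [S] have a join above that of [S]; the
    definition is applied to them instead of [S]. *)
Lemma totally_below_sup u v S : totally_below u v -> qle v (qsup S) ->
  exists2 s, S s & totally_below u s.
Proof.
move=> uv vS.
have [|u' [s Ss u's] uu'] :=
    uv [set u' | exists2 s, S s & totally_below u' s].
  apply: qle_trans vS _; apply: qsup_le => s Ss.
  by apply: le_of_totally_below => u' u's; apply: qsup_ub; exists s.
by exists s => // S' /u's [s' S's' u's']; exists s' => //; exact: qle_trans u's'.
Qed.

Lemma qmul_le_of_totally_below u v w :
  (forall u', totally_below u' u -> qle (qmul u' v) w) -> qle (qmul u v) w.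
Proof.
move=> h.
apply: (@qle_trans _ _ (qmul v (qsup [set u' | totally_below u' u]))).
  rewrite qmulC; apply: qmul_le; [exact: qle_refl|exact: totally_below_dense].
by rewrite qmul_sup; apply: qsup_le => _ [u' /h + <-]; rewrite qmulC.
Qed.

Lemma qmulr1 u : qmul u (qunit Q) = u.
Proof. by rewrite qmulC qmul1. Qed.

Lemma qmul_lel u v w : qle u v -> qle (qmul u w) (qmul v w).
Proof. by move=> uv; apply: qmul_le => //; exact: qle_refl. Qed.

Lemma qmul_ler u v w : qle v w -> qle (qmul u v) (qmul u w).
Proof. by move=> uv; apply: qmul_le => //; exact: qle_refl. Qed.

Lemma qmul_sup_le S u w : (forall s, S s -> qle (qmul s u) w) ->
  qle (qmul (qsup S) u) w.
Proof.
by move=> Sw; rewrite qmulC qmul_sup; apply: qsup_le => _ [s /Sw + <-]; rewrite qmulC.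
Qed.

Lemma qmul_bot_le u w : qle (qmul (qbot Q) u) w.
Proof. exact: qmul_sup_le. Qed.

(** * Extension of relations to ultrafilters, computed on cuts *)

Lemma uext_le_sup X Y (r : vrel Q X Y) (F : ultrafilter X) (G : ultrafilter Y)
    A B : F A -> G B ->
  qle (uext r F G) (qsup [set r x y | x in A & y in B]).
Proof. by move=> FA GB; apply: qinf_lb; exists A => //; exists B. Qed.

Lemma uext_ge X Y (r : vrel Q X Y) (F : ultrafilter X) (G : ultrafilter Y) u :
  (forall A B, F A -> G B -> exists x y, [/\ A x, B y & qle u (r x y)]) ->
  qle u (uext r F G).
Proof.
move=> h; apply: qinf_ge => _ [A FA [B GB <-]].
have [x [y [Ax By urxy]]] := h _ _ FA GB.
by apply: qle_trans urxy _; apply: qsup_ub; exists x => //; exists y.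
Qed.

Lemma uext_totally_below X Y (r : vrel Q X Y) (F : ultrafilter X)
    (G : ultrafilter Y) u A B : totally_below u (uext r F G) -> F A -> G B ->
  exists x y, [/\ A x, B y & totally_below u (r x y)].
Proof.
move=> uFG FA GB; have [_ [x Ax [y By <-]] uxy] :=
  totally_below_sup uFG (uext_le_sup r FA GB).
by exists x, y.
Qed.

(** Otherwise the complement of the image would be in [G], and [A] and this complement would contain
    a pair in the cut. *)
Lemma uext_totally_below_im X Y (r : vrel Q X Y) (F : ultrafilter X)
    (G : ultrafilter Y) u A : totally_below u (uext r F G) -> F A ->
  G [set y | exists2 x, A x & totally_below u (r x y)].
Proof.
move=> uFG FA; set B := (X in G X); case: (uf_setVsetC G B) => // GnB.
have [x [y [Ax + uxy]]] := uext_totally_below uFG FA GnB.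
by case; exists x.
Qed.

Lemma uext_mono X Y (r s : vrel Q X Y) F G :
  vrel_le r s -> qle (uext r F G) (uext s F G).
Proof.
move=> rs; apply: le_of_totally_below => u uFG; apply: uext_ge => A B FA GB.
have [x [y [Ax By /totally_below_le uxy]]] := uext_totally_below uFG FA GB.
by exists x, y; split=> //; exact: qle_trans (rs x y).
Qed.

Lemma uext_uimager X Y Z (r : vrel Q X Z) (g : Y -> Z) F G :
  uext r F (uimage g G) = uext (fun x y => r x (g y)) F G.
Proof.
apply: qle_anti; apply: le_of_totally_below => u uFG; apply: uext_ge => A B FA GB.
- have [|x [_ [Ax [y By <-] /totally_below_le uxy]]] :=
    uext_totally_below uFG FA (B := g @` B).
    by apply: uf_sub GB => y By; exists y.
  by exists x, y.
- have [x [y [Ax By /totally_below_le uxy]]] := uext_totally_below uFG FA GB.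
  by exists x, (g y).
Qed.

Lemma uext_uimagel X Y Z (r : vrel Q Z Y) (g : X -> Z) F G :
  uext r (uimage g F) G = uext (fun x y => r (g x) y) F G.
Proof.
apply: qle_anti; apply: le_of_totally_below => u uFG; apply: uext_ge => A B FA GB.
- have [|_ [y [[x Ax <-] By /totally_below_le uxy]]] :=
    uext_totally_below uFG _ GB (A := g @` A).
    by apply: uf_sub FA => x Ax; exists x.
  by exists x, y.
- have [x [y [Ax By /totally_below_le uxy]]] := uext_totally_below uFG FA GB.
  by exists (g x), y.
Qed.

Lemma uext_diag_ge X (r : vrel Q X X) F u :
  (forall x, qle u (r x x)) -> qle u (uext r F F).
Proof.
move=> ur; apply: uext_ge => A B FA FB.
by have [x [Ax Bx]] := uf_ex (uf_setI FA FB); exists x, x.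
Qed.

Lemma uext_principal_ge X Y (r : vrel Q X Y) x y :
  qle (r x y) (uext r (uprincipal x) (uprincipal y)).
Proof.
apply: uext_ge => A B /uprincipalP Ax /uprincipalP By.
by exists x, y; split=> //; exact: qle_refl.
Qed.

(** The image of [A] under a cut of [r] is in [G], so a pair in a cut of [s] can be chosen to start
    in it. *)
Lemma uext_vcomp_ge X Y Z (r : vrel Q X Y) (s : vrel Q Y Z) F G H :
  qle (qmul (uext r F G) (uext s G H)) (uext (vcomp s r) F H).
Proof.
apply: qmul_le_of_totally_below => u uFG.
rewrite qmulC; apply: qmul_le_of_totally_below => v vGH; rewrite qmulC.
apply: uext_ge => A C FA HC.
have [y [z [[x Ax uxy] Cz vyz]]] :=
  uext_totally_below vGH (uext_totally_below_im uFG FA) HC.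
exists x, z; split=> //.
apply: qle_trans (qmul_le (totally_below_le uxy) (totally_below_le vyz)) _.
by apply: qsup_ub; exists y.
Qed.

Lemma uext_umult X Y (r : vrel Q X Y) W V :
  qle (uext (uext r) W V) (uext r (umult W) (umult V)).
Proof.
apply: qinf_ge => _ [A WA [B VB <-]].
apply: (@qle_trans Q _ _ _ (uext_le_sup (uext r) WA VB)).
by apply: qsup_le => _ [F FA [G GB <-]]; exact: uext_le_sup.
Qed.

(* The nontrivial half of the naturality of [umult] with respect to relations. *)
Lemma uext_umult_lift X Y (r : vrel Q X Y) (F : ultrafilter X)
    (V : ultrafilter (ultrafilter Y)) u :
  totally_below u (uext r F (umult V)) ->
  exists2 W, umult W = F & qle u (uext (uext r) W V).
Proof.
move=> uFV.
(* An ultrafilter contains [sharps] exactly when [umult] sends it to [F]. *)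
pose sharps : set_system (ultrafilter X) :=
  [set AA | exists2 A, F A & usharp A `<=` AA].
have sharpsP : Filter sharps.
  split.
  - by exists setT; [exact: uf_setT|].
  - move=> AA BB [A FA AAA] [B FB BBB]; exists (A `&` B); first exact: uf_setI.
    by move=> G GAB; split; [apply: AAA|apply: BBB]; apply: uf_sub GAB => x [].
  - by move=> AA BB AB [A FA AAA]; exists A => // G /AAA /AB.
have [|w [wu wF wV]] :=
  @ultra_lift _ _ (fun x y => qle u (uext r x y)) sharps V sharpsP.
  move=> AA BB [A FA AAA] VBB.
  (* Some [G] in [BB] contains the image of [A] under the cut; it is then lifted along the cut to an
     ultrafilter containing [A]. *)
  have [G [BG AG]] := uf_ex (uf_setI VBB (uext_totally_below_im uFV FA)).
  have [|w [wR wA wG]] := @ultra_lift _ _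
    (fun x y => totally_below u (r x y)) (globally A) G (globally_filter A).
    move=> A' B AA' GB; have [y [By [x Ax uxy]]] := uf_ex (uf_setI GB AG).
    by exists x, y; split=> //; apply: AA'.
  exists (uimage fst w), G; split=> //; first by apply: AAA; exact: wA.
  apply: uext_ge => A' B' wA' wB'; rewrite -{}wG in wB'.
  have [p [A'p B'p /totally_below_le Rp]] := uf_pair_ex wR wA' wB'.
  by exists p.1, p.2.
exists (uimage fst w); first by apply/esym/uf_eq_sub => A FA; apply: wF; exists A.
apply: uext_ge => A' B' wA' wB'; rewrite -{}wV in wB'.
have [p [A'p B'p Rp]] := uf_pair_ex wu wA' wB'.
by exists p.1, p.2.
Qed.

(** Preservation of nonempty meets by [qmul] reduces the product of the two extensions to products
    of joins. These involve two separate members of [G], and a common [y] is found in their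
    intersection. *)
Lemma qmul_uext_ge X Y Z (r : vrel Q X Y) (s : vrel Q Y Z)
    (F : ultrafilter X) (G : ultrafilter Y) (H : ultrafilter Z) u :
  (forall A B C, F A -> G B -> H C -> exists x y z,
     [/\ A x, B y, C z & qle u (qmul (r x y) (s y z))]) ->
  qle u (qmul (uext r F G) (uext s G H)).
Proof.
move=> h.
apply: (qmul_inf_ge HQ).
  exists (qsup [set s x y | x in setT & y in setT]).
  by exists setT; [exact: uf_setT|exists setT => //; exact: uf_setT].
move=> _ [B GB [C HC <-]]; rewrite qmulC; apply: (qmul_inf_ge HQ).
  exists (qsup [set r x y | x in setT & y in setT]).
  by exists setT; [exact: uf_setT|exists setT => //; exact: uf_setT].
move=> _ [A FA [B' GB' <-]].
have [x [y [z [Ax [By B'y] Cz uxyz]]]] := h _ _ _ FA (uf_setI GB GB') HC.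
apply: qle_trans uxyz _; rewrite qmulC; apply: qmul_le; apply: qsup_ub.
  by exists y => //; exists z.
by exists x => //; exists y.
Qed.

(** * Kleisli composition and its associativity *)

Lemma vcomp_umult_ge X Y (r : vrel Q (ultrafilter (ultrafilter X)) Y) W y :
  qle (r W y) (vcomp r (vconverse (vgraph Q (@umult X))) (umult W) y).
Proof.
apply: qsup_ub; exists W => //; rewrite /vconverse /vgraph asboolT //.
exact: qmul1.
Qed.

(** Together with [kcomp_le], this turns the two nested joins and the graph of [umult] into one join
    over [W] and [G], with [umult W] fixed. *)
Lemma kcomp_ge X Y Z (s : urel Q Y Z) (r : urel Q X Y) W G z :
  qle (qmul (uext r W G) (s G z)) (kcomp s r (umult W) z).
Proof.
apply: (@qle_trans Q _ _ _ (qmul_lel _ (vcomp_umult_ge (uext r) W G))).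
by apply: qsup_ub; exists G.
Qed.

Lemma kcomp_le X Y Z (s : urel Q Y Z) (r : urel Q X Y) F z v :
  (forall W G, umult W = F -> qle (qmul (uext r W G) (s G z)) v) ->
  qle (kcomp s r F z) v.
Proof.
move=> h; apply: qsup_le => _ [G _ <-]; apply: qmul_sup_le => _ [W _ <-].
rewrite /vconverse /vgraph; case: asboolP => [/h|_]; first by rewrite qmul1.
by rewrite -qmulA; exact: qmul_bot_le.
Qed.

Lemma kcomp_leP X Y Z (s : urel Q Y Z) (r : urel Q X Y) (q : urel Q X Z) :
  vrel_le (kcomp s r) q <->
  forall W G z, qle (qmul (uext r W G) (s G z)) (q (umult W) z).
Proof.
split=> h; first by move=> W G z; exact: qle_trans (kcomp_ge _ _ _ _ _) (h _ _).
by move=> F z; apply: kcomp_le => W G <-.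
Qed.

Lemma kcomp_mono X Y Z (s s' : urel Q Y Z) (r r' : urel Q X Y) :
  vrel_le s s' -> vrel_le r r' -> vrel_le (kcomp s r) (kcomp s' r').
Proof.
move=> ss' rr'; apply/kcomp_leP => W G z; apply: qle_trans (kcomp_ge _ _ _ _ _).
by apply: qmul_le; [exact: uext_mono|exact: ss'].
Qed.

Lemma vrel_le_anti X Y (r s : vrel Q X Y) : vrel_le r s -> vrel_le s r -> r = s.
Proof.
by move=> rs sr; apply/funext => x; apply/funext => y; apply: qle_anti.
Qed.

Lemma vrel_le_refl X Y (r : vrel Q X Y) : vrel_le r r.
Proof. by move=> x y; exact: qle_refl. Qed.

Lemma vrel_le_trans X Y (s r t : vrel Q X Y) :
  vrel_le r s -> vrel_le s t -> vrel_le r t.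
Proof. by move=> rs st x y; exact: qle_trans (rs x y) (st x y). Qed.

Lemma qmul_kcomp_le X Y Z (s : urel Q Y Z) (r : urel Q X Y) F z u v :
  (forall W G, umult W = F -> qle (qmul u (qmul (uext r W G) (s G z))) v) ->
  qle (qmul u (kcomp s r F z)) v.
Proof.
move=> h; rewrite qmul_sup; apply: qsup_le => _ [_ [G _ <-] <-].
rewrite qmulC -qmulA; apply: qmul_sup_le => _ [W _ <-].
rewrite /vconverse /vgraph; case: asboolP => [/(h _ G)|_]; last first.
  by rewrite -qmulA; exact: qmul_bot_le.
by rewrite qmul1 (qmulA (uext r W G)) (qmulC _ u).
Qed.

Lemma kcompA_le X Y Z T (t : urel Q Z T) (s : urel Q Y Z) (r : urel Q X Y) :
  vrel_le (kcomp (kcomp t s) r) (kcomp t (kcomp s r)).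
Proof.
apply/kcomp_leP => W G z; apply: qmul_kcomp_le => V H VG; rewrite -{}VG.
(* Here [G] is [umult V]; lifting [W] to some [WW] over [V] makes the extensions of [r] and [s]
   composable. *)
apply: qmul_le_of_totally_below => u /uext_umult_lift[WW <- uWV].
rewrite umult_umult qmulA; apply: qle_trans (kcomp_ge _ _ _ _ _).
apply: qmul_lel; apply: qle_trans (qmul_lel _ uWV) _.
apply: (@qle_trans Q _ _ _ (uext_vcomp_ge _ _ _ _ _)).
rewrite uext_uimagel; apply: uext_mono => F x; apply: qsup_le => _ [K _ <-].
exact: kcomp_ge.
Qed.

Lemma kcomp_totally_below X Y Z (s : urel Q Y Z) (r : urel Q X Y) F z u :
  totally_below u (kcomp s r F z) ->
  exists W G, umult W = F /\ qle u (qmul (uext r W G) (s G z)).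
Proof.
move=> uF.
have [|_ [W [G [WF <-]]] uWG] := uF [set v | exists W G, umult W = F /\
   qmul (uext r W G) (s G z) = v].
  by apply: kcomp_le => W G WF; apply: qsup_ub; exists W, G.
by exists W, G.
Qed.

Lemma kcompA_ge X Y Z T (t : urel Q Z T) (s : urel Q Y Z) (r : urel Q X Y) :
  vrel_le (kcomp t (kcomp s r)) (kcomp (kcomp t s) r).
Proof.
apply/kcomp_leP => W H x; apply: qmul_le_of_totally_below => u uWH.
(* [q] is a pair of intermediate ultrafilters witnessing that the composite at [(F, z)] is above
   [u]. Pushing an ultrafilter on the pairs [(F, z)] forward along a choice of witnesses gives the
   intermediate ultrafilters for [W] and [H]. *)
pose R (F : ultrafilter X) z (q : ultrafilter (ultrafilter X) * ultrafilter Y) :=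
  umult q.1 = F /\ qle u (qmul (uext r q.1 q.2) (s q.2 z)).
have [||w [wR wW wH]] :=
    @ultra_lift _ _ (fun F z => exists q, R F z q) (ufset W) H.
- exact: (@filter_filter _ _ (@ultra_proper _ _ (ufsetP W))).
- move=> A B WA HB; have [F [z [AF Bz uFz]]] := uext_totally_below uWH WA HB.
  by have [V [G [VF uVG]]] := kcomp_totally_below uFz; exists F, z; split=> //;
    exists (V, G).
have {}wW : uimage fst w = W by apply/esym/uf_eq_sub.
(* [q0] is a default value for pairs without witness, a set which is not in [w]. *)
have [_ [q0 _]] := uf_ex wR.
have /choice[f fR] p : exists q, (exists q', R p.1 p.2 q') -> R p.1 p.2 q.
  case: (pselect (exists q, R p.1 p.2 q)) => [[q pq]|np].
    by exists q.
  by exists q0 => /np.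
pose WW := uimage (fst \o f) w; pose GG := uimage (snd \o f) w.
have WWE : uimage (@umult X) WW = W.
  rewrite -wW /WW -uimage_comp; apply: (uimage_eq_on wR) => p /fR[] //.
have uWG : qle u (qmul (uext (uext r) WW GG) (uext s GG H)).
  rewrite -wH; apply: qmul_uext_ge => A B C wA wB wC.
  have [p [[[Ap Bp] Cp] /fR[_ up]]] := uf_ex (uf_setI (uf_setI (uf_setI
    (wA : w ((fst \o f) @^-1` A)) (wB : w ((snd \o f) @^-1` B)))
    (wC : w (snd @^-1` C))) wR).
  by exists (f p).1, (f p).2, p.2.
rewrite -WWE -umult_umult.
apply: qle_trans (kcomp_ge _ _ _ (umult GG) _).
apply: qle_trans (qmul_lel _ uWG) _; rewrite -qmulA.
by apply: qmul_le; [exact: uext_umult|exact: kcomp_ge].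
Qed.

Lemma kcompA X Y Z T (t : urel Q Z T) (s : urel Q Y Z) (r : urel Q X Y) :
  kcomp t (kcomp s r) = kcomp (kcomp t s) r.
Proof. by apply: vrel_le_anti; [exact: kcompA_ge|exact: kcompA_le]. Qed.

(** * Spaces and modules *)

Lemma space_refl (X : space Q) (x : X) : qle (qunit Q) (conv (uprincipal x) x).
Proof.
apply: qle_trans ((spaceP X).1 _ x).
by rewrite /vconverse /vgraph asboolT //; exact: qle_refl.
Qed.

Lemma space_trans (X : space Q) W (F : ultrafilter X) (x : X) :
  qle (qmul (uext (@conv _ X) W F) (conv F x)) (conv (umult W) x).
Proof. by have /kcomp_leP := (spaceP X).2; apply. Qed.

Lemma is_spaceI (X : ugraph Q) :
  (forall x : X, qle (qunit Q) (conv (uprincipal x) x)) ->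
  vrel_le (kcomp (@conv _ X) (@conv _ X)) (@conv _ X) -> is_space X.
Proof.
move=> Xr Xt; split=> // F x; rewrite /vconverse /vgraph.
by case: asboolP => [<- //|_]; exact: qsup_le.
Qed.

Lemma uext_conv_principal (X : space Q) (F : ultrafilter X) :
  qle (qunit Q) (uext (@conv _ X) (uimage (@uprincipal X) F) F).
Proof. by rewrite uext_uimagel; apply: uext_diag_ge; exact: space_refl. Qed.

Lemma kcomp_conv_ge (X : space Q) Y (r : urel Q X Y) :
  vrel_le r (kcomp r (@conv _ X)).
Proof.
move=> F y; rewrite -{2}(umult_uimage_principal F).
apply: qle_trans (kcomp_ge _ _ _ F _).
by rewrite -{1}[r F y]qmul1; apply: qmul_lel; exact: uext_conv_principal.
Qed.

Lemma conv_kcomp_ge X (Y : space Q) (r : urel Q X Y) :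
  vrel_le r (kcomp (@conv _ Y) r).
Proof.
move=> F y; rewrite -{2}(umult_principal F).
apply: qle_trans (kcomp_ge _ _ _ (uprincipal y) _).
by rewrite -{1}[r F y]qmulr1; apply: qmul_le;
  [exact: uext_principal_ge|exact: space_refl].
Qed.

Lemma is_moduleP (X Y : space Q) (r : urel Q X Y) : is_module r <->
  vrel_le (kcomp r (@conv _ X)) r /\ vrel_le (kcomp (@conv _ Y) r) r.
Proof.
split=> [[-> ->]|[rX rY]]; first by split; exact: vrel_le_refl.
by split; apply: vrel_le_anti => //; [exact: kcomp_conv_ge|exact: conv_kcomp_ge].
Qed.

(** Counit of the adjunction between [lower_star f] and [upper_star f]; the next lemma is its
    unit. *)
Lemma kcomp_lower_star_upper_star (X Y : space Q) (f : X -> Y) :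
  vrel_le (kcomp (lower_star f) (upper_star f)) (@conv _ Y).
Proof.
apply/kcomp_leP => W F y; rewrite /upper_star /lower_star.
by rewrite -(uext_uimager (@conv _ Y)); exact: space_trans.
Qed.

Lemma kcomp_upper_star_lower_star (X Y : space Q) (f : X -> Y) : is_map f ->
  vrel_le (@conv _ X) (kcomp (upper_star f) (lower_star f)).
Proof.
move=> fm F x; rewrite -{2}(umult_uimage_principal F).
apply: qle_trans (kcomp_ge _ _ _ (uimage f F) _).
rewrite /upper_star -[conv F x]qmul1; apply: qmul_le; last exact: fm.
rewrite uext_uimager uext_uimagel; apply: uext_diag_ge => {}x.
by rewrite /lower_star uimage_principal; exact: space_refl.
Qed.

Lemma lower_star_module (X Y : space Q) (f : X -> Y) : is_map f ->
  is_module (X := X) (Y := Y) (lower_star f).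
Proof.
move=> fm; apply/is_moduleP; split; apply/kcomp_leP => W F y; rewrite /lower_star.
  rewrite uimage_umult; apply: qle_trans _ (space_trans _ (uimage f F) _).
  apply: qmul_lel; rewrite uext_uimagel uext_uimager; apply: uext_mono; exact: fm.
rewrite uimage_umult -(uext_uimagel (@conv _ Y)); exact: space_trans.
Qed.

(** * Underlying order and uniqueness of left adjoints *)

Lemma is_map_mono (X Y : space Q) (f : X -> Y) x y : is_map f ->
  underlying_le x y -> underlying_le (f x) (f y).
Proof. by move=> fm /qle_trans; apply; rewrite -uimage_principal; exact: fm. Qed.

Lemma underlying_le_trans (X : space Q) (y x z : X) :
  underlying_le x y -> underlying_le y z -> underlying_le x z.
Proof.
move=> xy yz; rewrite /underlying_le -(umult_principal (uprincipal x)).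
apply: qle_trans (space_trans _ (uprincipal y) _).
rewrite -[qunit Q]qmul1; apply: qmul_le => //.
by apply: qle_trans xy _; exact: uext_principal_ge.
Qed.

Lemma adjoint_maps_unique (X Y : space Q) (f f' : X -> Y) (g : Y -> X) :
  T0 Y -> adjoint_maps f g -> adjoint_maps f' g -> f = f'.
Proof.
move=> YT; have le h h' : adjoint_maps h g -> adjoint_maps h' g ->
    forall x, underlying_le (h x) (h' x).
  move=> [hm _ _ hg] [_ _ gh' _] x.
  by apply: underlying_le_trans (hg (h' x)); exact: is_map_mono (gh' x).
by move=> fg f'g; apply/funext => x; apply: YT; apply: le.
Qed.

(** * The space of presheaves *)

Section Presheaf.
Variable X : space Q.

Definition presheaf_rel Z (h : Z -> presheaf X) : urel Q X Z :=
  fun F z => sval (h z) F tt.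

Lemma presheaf_relX Z (h : Z -> presheaf X) :
  kcomp (presheaf_rel h) (@conv _ X) = presheaf_rel h.
Proof.
apply/vrel_le_anti; last exact: kcomp_conv_ge.
apply/kcomp_leP => W F z; have /is_moduleP[/kcomp_leP h1 _] := svalP (h z).
exact: h1.
Qed.

(** This is the action of the one-point space on the module [h z], transported to the point [z]. *)
Lemma presheaf_rel_principal Z (h : Z -> presheaf X) W z :
  qle (uext (presheaf_rel h) W (uprincipal z)) (presheaf_rel h (umult W) z).
Proof.
have /is_moduleP[_ /kcomp_leP h2] := svalP (h z).
apply: qle_trans (h2 W (uprincipal tt) tt); rewrite qmulr1.
apply: le_of_totally_below => u uW; apply: uext_ge => A B WA /uprincipalP Btt.
have /(uext_totally_below uW WA)[F [_ [AF -> /totally_below_le uF]]] :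
  uprincipal z [set z] by exact/uprincipalP.
by exists F, tt.
Qed.

(* The lifting of [presheaf_rel id] through itself: the largest relation [d]
   such that [kcomp d (presheaf_rel id)] is below [presheaf_rel id]. *)
Definition lifting_conv : urel Q (presheaf X) (presheaf X) := fun P p =>
  qsup [set v | forall W,
    qle (qmul (uext (presheaf_rel id) W P) v) (presheaf_rel id (umult W) p)].

Lemma lifting_convP P p v : qle v (lifting_conv P p) <->
  forall W, qle (qmul (uext (presheaf_rel id) W P) v)
                (presheaf_rel id (umult W) p).
Proof.
split=> [vPp W|h]; last exact: qsup_ub.
apply: qle_trans (qmul_ler _ vPp) _; rewrite qmul_sup.
by apply: qsup_le => _ [w /= h <-].
Qed.

Lemma le_lifting_conv Z (h : Z -> presheaf X) (r : urel Q Z (presheaf X)) :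
  vrel_le r (fun F p => lifting_conv (uimage h F) p) <->
  vrel_le (kcomp r (presheaf_rel h)) (presheaf_rel id).
Proof.
split=> [rh|/kcomp_leP rh].
  apply/kcomp_leP => W F p; have /lifting_convP/(_ W) := rh F p.
  by rewrite uext_uimager.
by move=> F p; apply/lifting_convP => W; rewrite uext_uimager; exact: rh.
Qed.

(** Transitivity follows from the universal property: composing [lifting_conv] twice with the
    evaluation stays below the evaluation. *)
Lemma lifting_conv_space : is_space (Ugraph lifting_conv).
Proof.
have := le_lifting_conv id; rewrite (_ : (fun F p => _) = lifting_conv); last first.
  by apply/funext => P; rewrite uimage_id.
move=> leP; apply: is_spaceI => [p|/=].
  by apply/lifting_convP => W; rewrite qmulr1; exact: presheaf_rel_principal.
apply/leP; rewrite -kcompA; have /leP le1 := @vrel_le_refl _ _ lifting_conv.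
by apply: (vrel_le_trans _ le1); apply: kcomp_mono => //; exact: vrel_le_refl.
Qed.

(** The right-hand side is also what [is_map_tensor] obtains from the evaluation on the tensor
    product, so [lifting_conv] is the exponential structure. *)
Lemma is_map_lifting_conv (Z : space Q) (h : Z -> presheaf X) :
  @is_map _ Z (Ugraph lifting_conv) h <->
  vrel_le (kcomp (@conv _ Z) (presheaf_rel h)) (presheaf_rel h).
Proof.
split=> [hm|/kcomp_leP h1 F z].
  apply/kcomp_leP => W F z; have /lifting_convP/(_ W) := hm F z.
  by rewrite uext_uimager.
by apply/lifting_convP => W; rewrite uext_uimager; exact: h1.
Qed.

(** Rectangles over members of the marginals belong to [w]. With [uext_xi_lift], the extension is
    the join of the limit values of the evaluation along all [w] with the given marginals. *)
Lemma uext_le_xi Z (h : Z -> presheaf X) (w : ultrafilter (Z * ultrafilter X)) :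
  qle (qinf [set qsup A |
         A in ufset (uimage (fun p => presheaf_rel h p.2 p.1) w)])
      (uext (presheaf_rel h) (uimage snd w) (uimage fst w)).
Proof.
set k := fun p => _.
apply: qinf_ge => _ [A wA [B wB <-]].
pose C := (snd @^-1` A) `&` (fst @^-1` B).
apply: (@qle_trans _ _ (qsup (k @` C))); last first.
  by apply: qsup_le => _ [p [Ap Bp] <-]; apply: qsup_ub; exists p.2 => //; exists p.1.
apply: qinf_lb; exists (k @` C) => //.
by apply: uf_sub (uf_setI (wA : w (snd @^-1` A)) (wB : w (fst @^-1` B))) => p pC;
  exists p.
Qed.

Lemma uext_xi_lift Z (h : Z -> presheaf X) W F u :
  totally_below u (uext (presheaf_rel h) W F) ->
  exists w : ultrafilter (Z * ultrafilter X), [/\ uimage snd w = W,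
    uimage fst w = F &
    qle u (qinf [set qsup A |
      A in ufset (uimage (fun p => presheaf_rel h p.2 p.1) w)])].
Proof.
move=> uWF.
have [||w [wR wW wF]] := @ultra_lift _ _
  (fun G z => qle u (presheaf_rel h G z)) (ufset W) F.
- exact: (@filter_filter _ _ (@ultra_proper _ _ (ufsetP W))).
- move=> A B WA FB.
  have [G [z [AG Bz /totally_below_le uGz]]] := uext_totally_below uWF WA FB.
  by exists G, z.
exists (uimage (fun p => (p.2, p.1)) w); split.
- by rewrite -uimage_comp; apply/esym/uf_eq_sub.
- by rewrite -uimage_comp -wF.
apply: qinf_ge => _ [A wA <-].
have [p [Ap up]] := uf_ex (uf_setI
  (wA : w ((fun p => presheaf_rel h p.1 p.2) @^-1` A)) wR).
by apply: qle_trans up _; exact: qsup_ub.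
Qed.

Lemma is_map_tensor (Z : space Q) (h : Z -> presheaf X) :
  @is_map _ (tensor Z (op_graph X)) (value_graph Q)
    (fun p => presheaf_rel h p.2 p.1) <->
  vrel_le (kcomp (@conv _ Z) (presheaf_rel h)) (presheaf_rel h).
Proof.
split=> [hm|/kcomp_leP h1 w [z F]].
  apply/kcomp_leP => W G z; apply: qmul_le_of_totally_below => u.
  move=> /uext_xi_lift[w [wW wG uw]].
  have /= := hm w (z, umult W); rewrite wW wG => /(qconvP HQ); apply: qle_trans.
  rewrite qmulC; apply: qmul_le => //; rewrite -{1}[conv G z]qmulr1.
  apply: qmul_ler.
  (* In [op_graph X], [W] converges to [umult W] with value [qunit], as the image of [umult W] under
     [uprincipal] shows. *)
  have := vcomp_umult_ge (uext (@conv _ X))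
    (uimage (@uprincipal X) (umult W)) (umult W).
  rewrite umult_uimage_principal; apply: qle_trans; exact: uext_conv_principal.
apply/(qconvP HQ) => /=; rewrite qmulC.
apply: qle_trans (qmul_lel _ (uext_le_xi h w)) _.
move: (uimage snd w) (uimage fst w) => W G; rewrite qmulA.
apply: qle_trans (qmul_lel _ (h1 _ _ _)) _; rewrite qmulC.
(* The convergence in [op_graph X] is absorbed because [presheaf_rel h] is its own composite with
   the structure of [X]. *)
rewrite -{2}(presheaf_relX h) qmulC qmul_sup.
apply: qsup_le => _ [_ [V _ <-] <-]; rewrite qmulC.
rewrite /vconverse /vgraph; case: asboolP => [<-|_]; last first.
  by rewrite -qmulA; exact: qmul_bot_le.
by rewrite qmul1; exact: kcomp_ge.
Qed.

Lemma presheaf_convE : @presheaf_conv Q X = lifting_conv.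
Proof.
have LP : is_presheaf_structure lifting_conv.
  split=> [|Z h]; first exact: lifting_conv_space.
  exact: iff_trans (is_map_lifting_conv h) (iff_sym (is_map_tensor h)).
rewrite /presheaf_conv; case: pselect => [ex|[]]; last by exists lifting_conv.
exact: presheaf_structure_unique (svalP (cid ex)) LP.
Qed.

End Presheaf.

(** * The free Phi-cocomplete spaces *)

Section PhiSpace.
Variable Phi : module_class Q.

Local Notation "''Phi' X" := (Phi_space Phi X) (at level 8, X at level 2).

Definition Phi_rel (X : space Q) Z (d : Z -> 'Phi X) : urel Q X Z :=
  fun F z => sval (sval (d z)) F tt.

Local Notation ev X := (Phi_rel (@id ('Phi X))).

Lemma Phi_eq (X : space Q) (p q : 'Phi X) :
  (forall F, sval (sval p) F tt = sval (sval q) F tt) -> p = q.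
Proof.
move=> E; do 2 apply: sig_eq; apply/funext => F; apply/funext => -[]; exact: E.
Qed.

Lemma Phi_relX (X : space Q) Z (d : Z -> 'Phi X) :
  kcomp (Phi_rel d) (@conv _ X) = Phi_rel d.
Proof. exact: (presheaf_relX (fun z => sval (d z))). Qed.

Lemma Phi_convP (X : space Q) (P : ultrafilter ('Phi X)) (p : 'Phi X) v :
  qle v (conv P p) <->
  forall W, qle (qmul (uext (ev X) W P) v) (ev X (umult W) p).
Proof.
rewrite /= presheaf_convE; split=> [/lifting_convP h W|h].
  by have := h W; rewrite uext_uimager.
by apply/lifting_convP => W; rewrite uext_uimager; exact: h.
Qed.

(** The universal property of the lifting, restricted to ['Phi X]; it reduces colimits in ['Phi X]
    to composites of relations. *)
Lemma le_lower_star (X : space Q) B (d : B -> 'Phi X) (r : urel Q B ('Phi X)) :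
  vrel_le r (fun F p => conv (uimage d F) p) <->
  vrel_le (kcomp r (Phi_rel d)) (ev X).
Proof.
split=> [rd|/kcomp_leP rd F p].
  apply/kcomp_leP => W F p; have /Phi_convP/(_ W) := rd F p.
  by rewrite uext_uimager.
by apply/Phi_convP => W; rewrite uext_uimager; exact: rd.
Qed.

Lemma is_map_PhiP (X Z : space Q) (d : Z -> 'Phi X) : @is_map _ Z ('Phi X) d <->
  vrel_le (kcomp (@conv _ Z) (Phi_rel d)) (Phi_rel d).
Proof.
split=> [dm|/kcomp_leP h F z].
  apply/kcomp_leP => W F z; have /Phi_convP/(_ W) := dm F z.
  by rewrite uext_uimager.
by apply/Phi_convP => W; rewrite uext_uimager; exact: h.
Qed.

Lemma kcomp_conv_ev (X : space Q) :
  vrel_le (kcomp (@conv _ ('Phi X)) (ev X)) (ev X).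
Proof. by apply/is_map_PhiP; exact: is_map_id. Qed.

Lemma Phi_rel_module (X Z : space Q) (d : Z -> 'Phi X) :
  @is_map _ Z ('Phi X) d -> is_module (X := X) (Y := Z) (Phi_rel d).
Proof.
move=> /is_map_PhiP dm; apply/is_moduleP; split=> //.
by rewrite Phi_relX; exact: vrel_le_refl.
Qed.

(** Membership is tested at the points [z], where the composite is [d z] because the structure of
    [Z] is absorbed. *)
Lemma Phi_rel_mem (X Z : space Q) (d : Z -> 'Phi X) :
  @is_map _ Z ('Phi X) d -> Phi X Z (Phi_rel d).
Proof.
move=> dm; have [_ dZ] := Phi_rel_module dm.
apply/mc_pointwise => [|z]; first exact: Phi_rel_module.
suff -> : kcomp (point_star z) (Phi_rel d) = sval (sval (d z)) by exact: svalP (d z).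
apply/funext => F; apply/funext => -[].
exact: (congr1 (fun r : urel Q X Z => r F z) dZ).
Qed.

(** * Modules as maps into presheaf spaces *)

Section Transpose.
Variables (X Z : space Q) (r : Phi_Mod_hom Phi X Z).

Lemma transpose_mem z :
  Phi X (one_space Q) (kcomp (point_star z) (sval r)).
Proof. by case: r => s sP; apply: mc_comp sP; exact: Phi_point_star. Qed.

Definition transpose (z : Z) : 'Phi X :=
  exist (fun p : presheaf X => Phi X (one_space Q) (sval p))
    (exist _ _ (mc_module (transpose_mem z))) (transpose_mem z).

Lemma Phi_rel_transpose : Phi_rel transpose = sval r.
Proof. exact: (mc_module (svalP r)).2. Qed.

Lemma transpose_map : @is_map _ Z ('Phi X) transpose.
Proof.
apply/is_map_PhiP; rewrite Phi_rel_transpose.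
by have [_ ->] := mc_module (svalP r); exact: vrel_le_refl.
Qed.

End Transpose.

(** * Precomposition with a module *)

Section Precomp.
Variables (X Y : space Q) (r : Phi_Mod_hom Phi Y X).

Definition precomp (p : 'Phi X) : 'Phi Y :=
  exist (fun p : presheaf Y => Phi Y (one_space Q) (sval p))
    (exist _ _ (mc_module (mc_comp (svalP p) (svalP r))))
    (mc_comp (svalP p) (svalP r)).

Lemma Phi_rel_precomp Z (d : Z -> 'Phi X) :
  Phi_rel (precomp \o d) = kcomp (Phi_rel d) (sval r).
Proof. by []. Qed.

Lemma precomp_map : @is_map _ ('Phi X) ('Phi Y) precomp.
Proof.
apply/is_map_PhiP; rewrite (Phi_rel_precomp id) kcompA.
by apply: kcomp_mono; [exact: kcomp_conv_ev|exact: vrel_le_refl].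
Qed.

End Precomp.

(** * Pointwise order, Yoneda lemma and suprema *)

Lemma Phi_underlying_leP (X : space Q) (p q : 'Phi X) :
  underlying_le p q <-> forall F, qle (ev X F p) (ev X F q).
Proof.
split=> [pq F|pq].
  have /kcomp_leP/(_ (uprincipal F) (uprincipal p) q) := @kcomp_conv_ev X.
  rewrite umult_principal; apply: qle_trans; rewrite -{1}[ev X F p]qmulr1.
  by apply: qmul_le => //; exact: (uext_principal_ge (ev X)).
apply/Phi_convP => W; rewrite qmulr1; apply: qle_trans (pq _).
exact: (presheaf_rel_principal (fun p : 'Phi X => sval p)).
Qed.

Lemma Phi_T0 (X : space Q) : T0 ('Phi X).
Proof.
move=> p q /Phi_underlying_leP pq /Phi_underlying_leP qp.
by apply: Phi_eq => F; apply: qle_anti; [exact: pq|exact: qp].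
Qed.

Lemma yoneda_map (X : space Q) : is_map (@yoneda _ Phi X).
Proof. by apply/is_map_PhiP; exact: (spaceP X).2. Qed.

(** Both inequalities are [le_lower_star] for the Yoneda embedding, whose relation is the structure
    of [X], absorbed by the evaluation. *)
Lemma yoneda_lemma (X : space Q) : lower_star (@yoneda _ Phi X) = ev X.
Proof.
apply: vrel_le_anti.
  have /le_lower_star := @vrel_le_refl _ _ (lower_star (@yoneda _ Phi X)).
  by apply: vrel_le_trans; exact: kcomp_conv_ge.
apply/le_lower_star; rewrite (_ : Phi_rel _ = @conv _ X) // Phi_relX.
exact: vrel_le_refl.
Qed.

Definition ev_hom (X : space Q) : Phi_Mod_hom Phi X ('Phi X) :=
  exist _ (ev X) (Phi_rel_mem (@is_map_id _ ('Phi X))).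

Definition upper_star_yoneda (X : space Q) : Phi_Mod_hom Phi ('Phi X) X :=
  exist _ _ (mc_upper_star Phi (@yoneda_map X)).

Lemma Phi_Sup_adjoint (X : space Q) :
  adjoint_maps (precomp (ev_hom X)) (@yoneda _ Phi ('Phi X)).
Proof.
split; [exact: precomp_map|exact: yoneda_map| |].
- move=> p; apply/Phi_underlying_leP => F; apply/Phi_convP => W.
  exact: (kcomp_ge (sval (sval p)) (ev X) W F tt).
- move=> p; apply/Phi_underlying_leP => F; have := @kcomp_conv_ev X F p.
  exact.
Qed.

(** Precomposition turns the unit and counit for the two modules of [yoneda] into those of an
    adjunction of maps, with the sides exchanged. *)
Lemma Phi_Sup_left_adjoint (X : space Q) :
  adjoint_maps (precomp (upper_star_yoneda X)) (precomp (ev_hom X)).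
Proof.
split; [exact: precomp_map|exact: precomp_map| |] => p;
    apply/Phi_underlying_leP => F.
- have := kcomp_mono (@vrel_le_refl _ _ (sval (sval p)))
    (kcomp_upper_star_lower_star (@yoneda_map X)).
  by rewrite yoneda_lemma kcompA (mc_module (svalP p)).1; apply.
- have := kcomp_mono (@vrel_le_refl _ _ (sval (sval p)))
    (@kcomp_lower_star_upper_star _ _ (@yoneda _ Phi X)).
  by rewrite yoneda_lemma kcompA (mc_module (svalP p)).1; apply.
Qed.

Lemma Phi_algebraic_Phi (X : space Q) : Phi_algebraic Phi ('Phi X).
Proof.
split; last by exists X, id, id; split=> //; exact: is_map_id.
split; [exact: Phi_T0|by exists (precomp (ev_hom X)); exact: Phi_Sup_adjoint|].
move=> Sup SupP.
rewrite (adjoint_maps_unique (@Phi_T0 X) SupP (Phi_Sup_adjoint X)).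
by exists (precomp (upper_star_yoneda X)); exact: Phi_Sup_left_adjoint.
Qed.

(** * Colimits and cocontinuous maps *)

Lemma is_colimit_of_rel (X A B : space Q) (psi : urel Q B A) (d : B -> 'Phi X)
    (g : A -> 'Phi X) : @is_map _ A ('Phi X) g ->
  Phi_rel g = kcomp psi (Phi_rel d) -> is_colimit (X := 'Phi X) psi d g.
Proof.
move=> gm gE; split=> //; first exact: lower_star_module.
  apply/le_lower_star; rewrite -kcompA -gE; apply/le_lower_star.
  exact: vrel_le_refl.
by move=> gamma _ /le_lower_star h; apply/le_lower_star; rewrite gE kcompA.
Qed.

(** The transpose of the composite is a colimit too; each colimit is below the other, and ['Phi X]
    is T0. *)
Lemma is_colimit_rel (X A B : space Q) (psi : urel Q B A) (d : B -> 'Phi X)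
    (g : A -> 'Phi X) : Phi B A psi -> @is_map _ B ('Phi X) d ->
  is_colimit (X := 'Phi X) psi d g -> Phi_rel g = kcomp psi (Phi_rel d).
Proof.
move=> psiP dm [gm gmod gpsi gmax].
pose r : Phi_Mod_hom Phi X A := exist _ _ (mc_comp psiP (Phi_rel_mem dm)).
rewrite -[RHS]/(sval r) -Phi_rel_transpose; congr Phi_rel.
have rm := transpose_map r.
have [_ rmod rpsi rmax] := is_colimit_of_rel rm (Phi_rel_transpose r).
apply/funext => a; apply: Phi_T0; rewrite /underlying_le.
  have := gmax _ rmod rpsi (uprincipal a) (transpose r a).
  by rewrite /lower_star !uimage_principal; apply: qle_trans; exact: space_refl.
have := rmax _ gmod gpsi (uprincipal a) (g a).
by rewrite /lower_star !uimage_principal; apply: qle_trans; exact: space_refl.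
Qed.

Lemma precomp_cocontinuous (X Y : space Q) (r : Phi_Mod_hom Phi Y X) :
  Phi_cocontinuous Phi (X := 'Phi X) (Y := 'Phi Y) (precomp r).
Proof.
move=> A B psi d g psiP dm gc; have [gm _ _ _] := gc.
apply: is_colimit_of_rel; first exact: is_map_comp (precomp_map r) gm.
by rewrite !Phi_rel_precomp kcompA (is_colimit_rel psiP dm gc).
Qed.

(* Every element of ['Phi X] is the colimit of [yoneda] weighted by itself. *)
Lemma cocontinuous_precomp (X Y : space Q) (f : 'Phi X -> 'Phi Y) :
  @is_map _ ('Phi X) ('Phi Y) f ->
  Phi_cocontinuous Phi (X := 'Phi X) (Y := 'Phi Y) f ->
  exists r : Phi_Mod_hom Phi Y X, precomp r = f.
Proof.
move=> fm fc; have fym := is_map_comp fm (@yoneda_map X).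
(* The module is the restriction of [f] to representable presheaves. *)
exists (exist _ _ (Phi_rel_mem fym)); apply/esym/funext => p.
have pm : @is_map _ (one_space Q) ('Phi X) (fun=> p) by exact: point_map.
have pc : is_colimit (X := 'Phi X) (sval (sval p)) (@yoneda _ Phi X) (fun=> p).
  apply: is_colimit_of_rel => //; rewrite (_ : Phi_rel (@yoneda _ _ _) = @conv _ X) //.
  rewrite (mc_module (svalP p)).1.
  by apply/funext => F; apply/funext; case.
have fpc := fc _ _ _ _ _ (svalP p) (@yoneda_map X) pc.
have E := is_colimit_rel (svalP p) fym fpc.
by apply: Phi_eq => F; exact: (congr1 (fun r : urel Q Y unit => r F tt) E).
Qed.

(** [r] is recovered from the values of [precomp r] on representable presheaves. *)
Lemma precomp_inj (X Y : space Q) (r s : Phi_Mod_hom Phi Y X) :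
  precomp r = precomp s -> r = s.
Proof.
move=> rs; apply: sig_eq.
have [_ <-] := mc_module (svalP r); have [_ <-] := mc_module (svalP s).
exact: (congr1 (fun f : 'Phi X -> 'Phi Y => Phi_rel (f \o @yoneda _ Phi X)) rs).
Qed.

Lemma iso_cocontinuous (X Y : space Q) (f : X -> Y) (g : Y -> X) :
  is_map f -> is_map g -> cancel f g -> cancel g f -> Phi_cocontinuous Phi f.
Proof.
move=> fm gm fK gK A B psi d h _ _ [hm hmod hpsi hmax].
have convE F y : conv (uimage f F) y = conv F (g y).
  apply: qle_anti; last by have := fm F (g y); rewrite gK.
  have := gm (uimage f F) y; rewrite -uimage_comp.
  by rewrite (_ : g \o f = id) ?uimage_id //; apply/funext.
have lowerE (C : space Q) (k : C -> X) F y :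
    lower_star (f \o k) F y = lower_star k F (g y).
  by rewrite /lower_star uimage_comp convE.
have fhm := is_map_comp fm hm.
split=> //; first exact: lower_star_module.
  move=> F y; rewrite lowerE; apply: qle_trans (hpsi F (g y)).
  by apply: kcomp_le => W G <-; rewrite lowerE; exact: kcomp_ge.
move=> gamma /is_moduleP[/kcomp_leP gA /kcomp_leP gY] gpsi F y.
pose gamma' : urel Q A X := fun F x => gamma F (f x).
rewrite lowerE -{1}(gK y); apply: (hmax gamma').
  apply/is_moduleP; split; apply/kcomp_leP => W G x; first exact: gA.
  have := gY W (uimage f G) (f x); rewrite convE fK.
  by rewrite uext_uimager.
move=> G x; apply: (@qle_trans _ _ _ _ (gpsi G (f x))).
by rewrite lowerE fK; exact: qle_refl.
Qed.

(** * Duality *)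

Lemma Phi_Mod_category : is_category (opposite (Phi_Mod Phi)).
Proof.
split=> [X Y f|X Y f|X Y Z T h g f]; apply: sig_eq => /=.
- exact: (mc_module (svalP f)).1.
- exact: (mc_module (svalP f)).2.
- by rewrite kcompA.
Qed.

Lemma Phi_Alg_sup_category : is_category (Phi_Alg_sup Phi).
Proof. by split=> *; apply: sig_eq. Qed.

Definition precomp_hom (X Y : space Q) (r : Phi_Mod_hom Phi Y X) :
    Phi_alg_hom Phi ('Phi X) ('Phi Y) :=
  exist _ (precomp r) (conj (precomp_map r) (precomp_cocontinuous r)).

Definition Phi_obj (X : space Q) : Phi_Alg_sup Phi :=
  exist _ ('Phi X) (Phi_algebraic_Phi X).

Lemma precomp_hom1 (X : opposite (Phi_Mod Phi)) :
  precomp_hom (idm X) = idm (Phi_obj X).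
Proof.
apply: sig_eq; apply/funext => p; apply: Phi_eq => F /=.
by rewrite (mc_module (svalP p)).1.
Qed.

Lemma precomp_homM (X Y Z : opposite (Phi_Mod Phi)) (g : hom Y Z) (f : hom X Y) :
  precomp_hom (cmp g f) =
  @cmp _ (Phi_obj X) (Phi_obj Y) (Phi_obj Z) (precomp_hom g) (precomp_hom f).
Proof.
by apply: sig_eq; apply/funext => p; apply: Phi_eq => F /=; rewrite kcompA.
Qed.

Definition Phi_functor : functor (opposite (Phi_Mod Phi)) (Phi_Alg_sup Phi) :=
  @Functor (opposite (Phi_Mod Phi)) (Phi_Alg_sup Phi) Phi_obj precomp_hom
    precomp_hom1 precomp_homM.

Lemma Phi_duality : dually_equivalent (Phi_Mod Phi) (Phi_Alg_sup Phi).
Proof.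
apply: (@fully_faithful_equivalent _ _ Phi_functor).
- exact: Phi_Mod_category.
- exact: Phi_Alg_sup_category.
- move=> X Y [f [fm fc]]; have [r rf] := cocontinuous_precomp fm fc.
  by exists r; exact: sig_eq.
- by move=> X Y r s /(congr1 sval); exact: precomp_inj.
- move=> [X [Xdis [Y [f [g [fm gm fK gK]]]]]].
  exists Y.
  exists (exist _ g (conj gm (iso_cocontinuous gm fm gK fK))).
  exists (exist _ f (conj fm (iso_cocontinuous fm gm fK gK))).
  by split; apply: sig_eq; apply/funext => x /=; [exact: gK|exact: fK].
Qed.

End PhiSpace.
End Quantale.

(** * The two quantales *)

Lemma topological_ultra_quantale : ultra_quantale topological.
Proof.
split.
- move=> [] //=; apply/asboolP => S /asboolP ST; by exists true.
- move=> [] [] // S [s0 Ss0] h; last by have := h _ Ss0.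
  by apply: bool_inf_ge => s /h.
- move=> F u v; set xi := qinf _.
  (* The limit value is false exactly when [F] contains the only nontrivial open set. *)
  have xiP : xi = ~~ `[< F [set false] >].
    rewrite /xi /= /bool_inf; congr (~~ _); apply: asbool_equiv_eq; split.
      by move=> [A FA /negbT/asboolPn nAt]; apply: uf_sub FA => -[].
    by move=> Ff; exists [set false] => //; apply/negbTE/asboolPn.
  rewrite xiP /= /sierpinski_conv.
  case: v; last first.
    rewrite implybF negb_and negbK; case: u => //=; split.
      by move=> /asboolP/(_ [set false]) h; apply/asboolP; apply: h => //; right; left.
    move=> /asboolP Ff; apply/asboolP => O [->|[->|->]] //.
    by move=> _; exact: uf_setT.
  rewrite !implybT; split=> // _; apply/implyP => _; apply/asboolP.
  by move=> O [->|[->|->]] // _; exact: uf_setT.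
Qed.

Lemma approach_ultra_quantale (R : realType) : ultra_quantale (approach R).
Proof.
split.
- move=> [[r| |] r0] //; rewrite /= /ennr_le /=; last exact: leey.
  (* For finite [r], every [r + e] with [e > 0] is totally below [r]. *)
  apply/lee_addgt0Pr => e e0; apply: ereal_inf_lbound.
  have re0 : (0 <= r%:E + e%:E)%E by rewrite adde_ge0 // lee_fin ltW.
  exists (Ennr re0) => // S /= rS.
  have [|_ [s Ss <-] se] :=
    @ereal_inf_lt _ [set val u | u in S] (r%:E + e%:E)%E.
    by apply: le_lt_trans rS _; rewrite lteDl // lte_fin.
  by exists s => //; exact: ltW.
- move=> u v S [s0 Ss0] h; rewrite /= /ennr_le /=.
  (* A member of [S] bounds [v] by [u], so that [v] is finite when [u] is and can be subtracted. *)
  have vu : (val v <= val u)%E.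
    by apply: le_trans (h _ Ss0); rewrite leeDl //; exact: (valP s0).
  case: u h vu => [[r| |] r0] //= h vr; last exact: leey.
  have vfin : val v \is a fin_num.
    by rewrite ge0_fin_numE ?(valP v) // (le_lt_trans vr) // ltry.
  rewrite -leeBrDl // ge_max; apply/andP; split; first by rewrite sube_ge0 ?vfin ?orbT.
  by apply: ge_ereal_sup => _ [s /h vs <-]; rewrite leeBrDl.
- move=> F u v.
  change (Order.max (val v - val (ennr_xi F)) 0 <= val u <->
          val v <= val u + val (ennr_xi F))%E.
  move: (ennr_xi F) => x; rewrite ge_max (valP u : (0 <= val u)%E) andbT.
  case: x => [[r| |] r0] //=.
    by rewrite EFinN leeBlDr.
  (* For an infinite limit value the difference is [-oo], even when [v] is [+oo], and both sides
     hold. *)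
  rewrite addey ?leey; last by rewrite gt_eqF // (lt_le_trans _ (valP u)) // ltNye.
  by rewrite addeNy leNye.
Qed.

Theorem theorem9p11 :
  (forall Phi : module_class topological,
     dually_equivalent (Phi_Mod Phi) (Phi_Alg_sup Phi)) /\
  (forall (R : realType) (Phi : module_class (approach R)),
     dually_equivalent (Phi_Mod Phi) (Phi_Alg_sup Phi)).
Proof.
split=> [Phi|R Phi]; apply: Phi_duality.
- exact: topological_ultra_quantale.
- exact: approach_ultra_quantale.
Qed.
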